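(* Let $p_X$ be a distribution on a finite set $\mathfrak{X}$, let $p_S$ be a distribution on $\{0,1,\dots,s_{\max}\}$, and let $p_{Y|X}$ be a conditional distribution with $X,Y$ taking values in $\mathfrak{X}$. Then for every seed order $d\ge 1$, the matching capacity of database matching under noisy column repetitions is $$C(d)=I(X;Y^S,S),$$ where $X\sim p_X$, $S\sim p_S$ is independent of $X$, and, conditioned on $X=x$ and $S=s$, $Y^S=(Y_1,\dots,Y_s)$ has distribution $\Pr(Y^S=(y_1,\dots,y_s)\mid X=x,S=s)=\prod_{i=1}^{s}p_{Y|X}(y_i\mid x)$ (with $Y^S$ the empty string when $S=0$).
   Context: Setup. An $(m_n,n,p_X)$ unlabeled database $\mathbf{D}^{(1)}$ is an $m_n\times n$ random matrix with i.i.d. entries drawn from $p_X$ on the finite set $\mathfrak{X}$. The column repetition pattern $S^n=(S_1,\dots,S_n)$ has i.i.d. entries drawn from $p_S$ on $\{0,\dots,s_{\max}\}$, independent of $\mathbf{D}^{(1)}$. $\boldsymbol{\Theta}_n$ is a uniformly random permutation of $[m_n]$, independent of $(\mathbf{D}^{(1)},S^n)$. The labeled noisy repeated database $\mathbf{D}^{(2)}$ is defined as follows: for each $i\in[m_n]$ and $j\in[n]$, its $(i,j)$-th block $D^{(2)}_{i,j}$ is the empty string if $S_j=0$, and otherwise is a row vector $Y_i^{S_j}$ of length $S_j$ whose entries, conditionally on $D^{(1)}_{\boldsymbol{\Theta}_n^{-1}(i),j}=x$, are i.i.d. with law $p_{Y|X}(\cdot\mid x)$ (independently across all $(i,j)$).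 Thus $\mathbf{D}^{(2)}$ has $K=\sum_j S_j$ columns; column $j$ of $\mathbf{D}^{(1)}$ is deleted if $S_j=0$ and replicated if $S_j>1$; row $i$ of $\mathbf{D}^{(2)}$ corresponds to row $\boldsymbol{\Theta}_n^{-1}(i)$ of $\mathbf{D}^{(1)}$. Seeds: a batch of $B=\Theta(n^d)$ seeds $(\mathbf{G}^{(1)},\mathbf{G}^{(2)})$ is a pair of matrices of sizes $B\times n$ and $B\times K$, where $\mathbf{G}^{(1)}$ has i.i.d. $p_X$ entries and $\mathbf{G}^{(2)}$ is obtained from $\mathbf{G}^{(1)}$ by the same repetition pattern $S^n$ and the same noise mechanism $p_{Y|X}$, with rows already correctly matched (identity correspondence); $d$ is the seed order. A matching scheme is a sequence of maps $\phi_n:(\mathbf{D}^{(1)},\mathbf{D}^{(2)},\mathbf{G}^{(1)},\mathbf{G}^{(2)})\mapsto\hat{\boldsymbol{\Theta}}_n$ (the pattern $S^n$ is not given); it is successful if $\Pr(\boldsymbol{\Theta}_n(J)\ne\hat{\boldsymbol{\Theta}}_n(J))\to0$ as $n\to\infty$, with $J$ uniform on $[m_n]$. The database growth rate is $R=\lim_{n\to\infty}\frac1n\log_2 m_n$. A rate $R$ is achievable for seed order $d$ if there is a successful matching scheme when the unlabeled database has growth rate $R$, and the matching capacity $C(d)$ is the supremum of achievable rates. Logarithms are base 2. *)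

(* Defs.v *)
From HB Require Import structures.
From mathcomp Require Import all_boot all_order all_algebra all_fingroup.
From mathcomp Require Import all_classical all_reals all_analysis.
Set Implicit Arguments. Unset Strict Implicit. Unset Printing Implicit Defensive.
Import Order.TTheory GRing.Theory Num.Theory.
Local Open Scope ring_scope.
Local Open Scope classical_set_scope.
Import numFieldNormedType.Exports.

Section Matching.
Variable R : realType.

Definition log2 (x : R) : R := ln x / ln 2.

Definition is_pmf (T : finType) (p : T -> R) : Prop :=
  (forall t, 0 <= p t) /\ \sum_(t : T) p t = 1.

Definition mutual_info (A B : finType) (P : A -> B -> R) : R :=
  \sum_(a : A) \sum_(b : B)
    (if P a b == 0 then 0 else
       P a b * log2 (P a b / ((\sum_(b' : B) P a b') * (\sum_(a' : A) P a' b)))).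

Variables (X : finType) (smax : nat).
Variables (pX : X -> R) (pS : 'I_smax.+1 -> R) (pYX : X -> X -> R).
(* pYX x y = p_{Y|X}(y | x) *)

Definition chan_prob (s : nat) (x : X) (y : s.-tuple X) : R :=
  \prod_(k < s) pYX x (tnth y k).

(* joint pmf of X and (Y^S, S); the pair (Y^S,S) is encoded as a dependent
   pair (S, Y^S) with Y^S an S-tuple (the empty tuple when S = 0) *)
Definition joint_XYS (x : X) (ys : {s : 'I_smax.+1 & (s : nat).-tuple X}) : R :=
  pX x * pS (tag ys) * chan_prob x (tagged ys).

Definition capacity_formula : R := mutual_info joint_XYS.

Definition db (m n : nat) := {ffun 'I_m -> {ffun 'I_n -> X}}.
Definition pattern (n : nat) := {ffun 'I_n -> 'I_smax.+1}.
(* channel outputs: for each (row, column) smax i.i.d. outputs of p_{Y|X};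
   the block D^(2)_{i,j} consists of the first S_j of them *)
Definition noise (m n : nat) := {ffun 'I_m -> {ffun 'I_n -> smax.-tuple X}}.

(* a row of the noisy repeated database: concatenation of the blocks
   (length K = sum_j S_j); the pattern S is not visible from the row *)
Definition repeated_row (n : nat) (S : pattern n)
    (z : {ffun 'I_n -> smax.-tuple X}) : seq X :=
  flatten [seq take (S j) (z j) | j <- enum 'I_n].

(* type of the n-th map of a matching scheme:
   (D1, D2, G1, G2) |-> estimated permutation *)
Definition scheme_map (m n B : nat) :=
  db m n -> ('I_m -> seq X) -> db B n -> ('I_B -> seq X) -> {perm 'I_m}.

Definition outcome_prob (m n B : nat) (D1 : db m n) (S : pattern n)
    (th : {perm 'I_m}) (Z : noise m n) (G1 : db B n) (W : noise B n) : R :=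
  (\prod_(i < m) \prod_(j < n) pX (D1 i j)) *
  (\prod_(j < n) pS (S j)) *
  (m`!%:R)^-1 *
  (\prod_(i < m) \prod_(j < n) \prod_(k < smax)
      pYX (D1 ((th^-1)%g i) j) (tnth (Z i j) k)) *
  (\prod_(b < B) \prod_(j < n) pX (G1 b j)) *
  (\prod_(b < B) \prod_(j < n) \prod_(k < smax)
      pYX (G1 b j) (tnth (W b j) k)).

(* Pr(Theta_n(J) <> hat Theta_n(J)), J uniform on [m] *)
Definition match_error (m n B : nat) (phi : scheme_map m n B) : R :=
  \sum_(D1 : db m n) \sum_(S : pattern n) \sum_(th : {perm 'I_m})
  \sum_(Z : noise m n) \sum_(G1 : db B n) \sum_(W : noise B n)
    outcome_prob D1 S th Z G1 W *
    ((#|[set i : 'I_m | th i !=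
        phi D1 (fun i' => repeated_row S (Z i')) G1
                (fun b => repeated_row S (W b)) i]|)%:R / m%:R).

Definition has_growth_rate (mseq : nat -> nat) (r : R) : Prop :=
  (fun n : nat => log2 (mseq n)%:R / n%:R) @ \oo --> r.

Definition seed_order (Bseq : nat -> nat) (d : R) : Prop :=
  exists c1 c2 : R, 0 < c1 /\ 0 < c2 /\
    \forall n \near \oo,
      c1 * (n%:R `^ d) <= (Bseq n)%:R /\ (Bseq n)%:R <= c2 * (n%:R `^ d).

Definition successful (mseq Bseq : nat -> nat)
    (phi : forall n, scheme_map (mseq n) n (Bseq n)) : Prop :=
  (fun n : nat => match_error (phi n)) @ \oo --> (0 : R).

Definition achievable (d r : R) : Prop :=
  forall mseq : nat -> nat, (forall n, (0 < mseq n)%N) ->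
  has_growth_rate mseq r ->
  forall Bseq : nat -> nat, seed_order Bseq d ->
  exists phi : forall n, scheme_map (mseq n) n (Bseq n),
    successful phi.

Definition matching_capacity (d : R) : R := sup [set r | achievable d r].

End Matching.

(* Main.v *)
Require Import Defs.
From HB Require Import structures.
From mathcomp Require Import all_boot all_order all_algebra all_fingroup.
From mathcomp Require Import all_classical all_reals all_analysis.
From mathcomp Require Import ring lra.
Set Implicit Arguments. Unset Strict Implicit. Unset Printing Implicit Defensive.
Import Order.TTheory GRing.Theory Num.Theory.
Import numFieldNormedType.Exports.
Local Open Scope ring_scope.

(** Each row of the first database is scored against each labeled row by the
    product over the columns of the likelihood ratios [p(y|x) / p(y)], [y]
    being the block of the column.

    Achievability: a matching pair has log-score about [n I] by a Chernoff
    bound, while a row independent of the labeled one reaches the score [tau]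
    with probability at most [1/tau]; keeping the unambiguous matches above
    [exp (n gamma)], with [gamma] between the rate and [I], works.  Cutting the
    labeled rows into blocks requires the pattern, which is read off the seeds:
    an output letter comes from column [j] exactly when its empirical
    correlation with that column is above a threshold, and the exponential
    bound in [B >= c n] beats the union over the [O(n^2)] tests.

    Converse: by the Gibbs variational inequality with the test function
    [ln m * #correct], applied to the joint law against the law where labeled
    and unlabeled rows are independent; in the latter the number of agreements
    of a uniform permutation with any fixed one satisfies [E m^N <= exp (m-1)].
    This gives [(1 - err) ln m <= n I + 1]. *)

(** * Product laws on finite functions and tuples *)

Section FiniteSums.
Variable R : realType.

Lemma sum_ffun_prod (I T : finType) (q : I -> T -> R) :
  \sum_(f : {ffun I -> T}) \prod_i q i (f i) = \prod_i \sum_t q i t.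
Proof. by rewrite bigA_distr_bigA. Qed.

Lemma sum_ffun_prod_pmf (I T : finType) (q : I -> T -> R) :
  (forall i, \sum_t q i t = 1) -> \sum_(f : {ffun I -> T}) \prod_i q i (f i) = 1.
Proof. by move=> q1; rewrite sum_ffun_prod big1. Qed.

Lemma sum_ffun_prod3 (I T U V : finType) (c : I -> T -> U -> V -> R) :
  \sum_(f : {ffun I -> T}) \sum_(g : {ffun I -> U}) \sum_(h : {ffun I -> V})
     \prod_i c i (f i) (g i) (h i) =
  \prod_i \sum_t \sum_u \sum_v c i t u v.
Proof.
rewrite bigA_distr_bigA; apply: eq_bigr => f _.
rewrite bigA_distr_bigA; apply: eq_bigr => g _.
by rewrite bigA_distr_bigA.
Qed.

Lemma prod_if_eq (I : finType) (k : I) (x : R) :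
  \prod_i (if i == k then x else 1) = x.
Proof. by rewrite -big_mkcond big_pred1_eq. Qed.

(** The factor [h (f k)] is absorbed into the [k]-th coordinate, so the sum factors and every other
    coordinate contributes 1. *)
Lemma sum_ffun_marginal (I T : finType) (q : I -> T -> R) (k : I) (h : T -> R) :
  (forall i, \sum_t q i t = 1) ->
  \sum_(f : {ffun I -> T}) (\prod_i q i (f i)) * h (f k) = \sum_t q k t * h t.
Proof.
move=> q1; transitivity (\sum_(f : {ffun I -> T})
    \prod_i (q i (f i) * (if i == k then h (f i) else 1))).
  apply: eq_bigr => f _; rewrite big_split /=; congr (_ * _).
  rewrite -[LHS](prod_if_eq k); apply: eq_bigr => i _.
  by case: eqP => // ->.
rewrite (sum_ffun_prod (fun i t => q i t * (if i == k then h t else 1))).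
rewrite (bigD1 k) //= eqxx [X in _ * X]big1 ?mulr1 // => i /negPf ->.
by rewrite -[RHS](q1 i); apply: eq_bigr => t _; rewrite mulr1.
Qed.

Lemma sum_ffun_marginal2 (I T : finType) (q : I -> T -> R) (k l : I)
    (h : T -> T -> R) : k != l -> (forall i, \sum_t q i t = 1) ->
  \sum_(f : {ffun I -> T}) (\prod_i q i (f i)) * h (f k) (f l) =
  \sum_t q k t * \sum_u q l u * h t u.
Proof.
move=> kl q1; have lk : l != k by rewrite eq_sym.
(* Freezing the value at [k] by an indicator turns [h] into a function of [f l] alone, so the
   summand becomes a product over coordinates. *)
have fixk t : \sum_(f : {ffun I -> T}) (\prod_i q i (f i)) *
    ((f k == t)%:R * h t (f l)) = q k t * \sum_u q l u * h t u.
  transitivity (\sum_(f : {ffun I -> T}) \prod_i (q i (f i) *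
      ((if i == k then (f i == t)%:R else 1) *
       (if i == l then h t (f i) else 1)))).
    apply: eq_bigr => f _; rewrite !big_split /=; congr (_ * (_ * _)).
      by rewrite -[LHS](prod_if_eq k); apply: eq_bigr => i _; case: eqP => // ->.
    by rewrite -[LHS](prod_if_eq l); apply: eq_bigr => i _; case: eqP => // ->.
  rewrite (sum_ffun_prod (fun i u => q i u * ((if i == k then (u == t)%:R else 1) *
       (if i == l then h t u else 1)))).
  rewrite (bigD1 k) //= (bigD1 l lk) /= !eqxx.
  rewrite (negPf kl) (negPf lk) [X in _ * (_ * X)]big1 ?mulr1; last first.
    move=> i /andP[/negPf -> /negPf ->].
    by rewrite -[RHS](q1 i); apply: eq_bigr => u _; rewrite !mulr1.
  congr (_ * _); last by apply: eq_bigr => u _; rewrite mul1r.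
  rewrite (bigD1 t) //= eqxx !mulr1 big1 ?addr0 // => u /negPf ->.
  by rewrite mul0r mulr0.
rewrite -(eq_bigr _ (fun t _ => fixk t)) exchange_big /=.
apply: eq_bigr => f _; rewrite -mulr_sumr; congr (_ * _).
rewrite (bigD1 (f k)) //= eqxx mul1r big1 ?addr0 // => t.
by rewrite eq_sym => /negPf ->; rewrite mul0r.
Qed.

(** The image of a product measure under a coordinatewise map is the product of the image measures.
    The converse uses it to replace noise by what is observed of it. *)
Lemma sum_ffun_push (I N T : finType) (v : I -> N -> R) (pi : I -> N -> T)
    (F : {ffun I -> T} -> R) :
  \sum_(f : {ffun I -> N}) (\prod_i v i (f i)) * F [ffun i => pi i (f i)] =
  \sum_(g : {ffun I -> T}) (\prod_i \sum_(z | pi i z == g i) v i z) * F g.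
Proof.
transitivity (\sum_(g : {ffun I -> T}) \sum_(f : {ffun I -> N})
    (\prod_i (if pi i (f i) == g i then v i (f i) else 0)) * F g).
  rewrite exchange_big /=; apply: eq_bigr => f _.
  rewrite (bigD1 [ffun i => pi i (f i)]) //= [X in _ = _ + X]big1 ?addr0.
    by congr (_ * _); apply: eq_bigr => i _; rewrite ffunE eqxx.
  move=> g gf; suff [i ni] : exists i, pi i (f i) != g i.
    by rewrite (bigD1 i) //= (negPf ni) !mul0r.
  apply/existsP; rewrite -negb_forall; apply: contra gf => /forallP fg.
  by apply/eqP/ffunP => i; rewrite ffunE (eqP (fg i)).
apply: eq_bigr => g _; rewrite -mulr_suml; congr (_ * _).
rewrite (sum_ffun_prod (fun i z => if pi i z == g i then v i z else 0)).
by apply: eq_bigr => i _; rewrite -big_mkcond.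
Qed.

Lemma sum_ffun_fiber (I N T : finType) (v : I -> N -> R) (pi : I -> N -> T)
    (g : {ffun I -> T}) :
  \sum_(f : {ffun I -> N} | [ffun i => pi i (f i)] == g) \prod_i v i (f i) =
  \prod_i \sum_(z | pi i z == g i) v i z.
Proof.
have := sum_ffun_push v pi (fun g' => (g' == g)%:R).
rewrite [in RHS](bigD1 g) //= eqxx mulr1 [X in _ = _ + X]big1 ?addr0.
  move=> <-; rewrite big_mkcond; apply: eq_bigr => f _.
  by case: ifP; rewrite ?mulr1 ?mulr0.
by move=> g' /negPf ->; rewrite mulr0.
Qed.

Lemma sum_tupleS (T : finType) n (F : n.+1.-tuple T -> R) :
  \sum_(z : n.+1.-tuple T) F z =
  \sum_(x : T) \sum_(z : n.-tuple T) F [tuple of x :: z].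
Proof.
rewrite pair_bigA (reindex (fun q : T * n.-tuple T => [tuple of q.1 :: q.2])) //.
exists (fun z : n.+1.-tuple T => (thead z, [tuple of behead z])) => [[x z] _|z _] /=.
  by congr pair; apply: val_inj.
by case/tupleP: z => x z; apply: val_inj.
Qed.

Lemma sum_tuple_prod1 (T : finType) (q : T -> R) n : \sum_t q t = 1 ->
  \sum_(z : n.-tuple T) \prod_(c <- z) q c = 1.
Proof.
move=> q1; elim: n => [|n IH].
  rewrite (bigD1 [tuple]) //= [X in _ + X]big1 ?addr0 ?big_nil // => z /eqP[].
  exact: tuple0.
rewrite sum_tupleS -[RHS]q1; apply: eq_bigr => x _.
rewrite -[RHS]mulr1 -[in RHS]IH mulr_sumr; apply: eq_bigr => z _.
by rewrite big_cons.
Qed.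

(** Letters beyond the prefix integrate out. This allows a block of random length to be modelled as
    a prefix of a tuple of fixed length. *)
Lemma sum_tuple_take (T : finType) (q : T -> R) (s u : nat) (h : seq T -> R) :
  \sum_t q t = 1 ->
  \sum_(z : (s + u).-tuple T) (\prod_(c <- z) q c) * h (take s z) =
  \sum_(y : s.-tuple T) (\prod_(c <- y) q c) * h y.
Proof.
move=> q1; elim: s h => [|s IH] h.
  rewrite [RHS](bigD1 [tuple]) //= [X in _ = _ + X]big1 ?addr0 ?big_nil; last first.
    by move=> z /eqP[]; exact: tuple0.
  rewrite mul1r -[RHS]mul1r -[X in _ = X * _](sum_tuple_prod1 u q1) mulr_suml.
  by apply: eq_bigr => z _; rewrite take0.
rewrite [LHS](@sum_tupleS T (s + u)) [RHS]sum_tupleS; apply: eq_bigr => x _.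
have := IH (fun y => h (x :: y)) => /(congr1 (fun r => q x * r)).
rewrite !mulr_sumr => E.
transitivity (\sum_(z : (s + u).-tuple T)
   q x * ((\prod_(c <- z) q c) * h (x :: take s z))).
  by apply: eq_bigr => z _ /=; rewrite big_cons mulrA.
by rewrite E; apply: eq_bigr => y _; rewrite big_cons mulrA.
Qed.

Lemma sum_tuple_take_le (T : finType) (q : T -> R) (s n : nat) (h : seq T -> R) :
  (s <= n)%N -> \sum_t q t = 1 ->
  \sum_(z : n.-tuple T) (\prod_(c <- z) q c) * h (take s z) =
  \sum_(y : s.-tuple T) (\prod_(c <- y) q c) * h y.
Proof. by move=> sn q1; have := sum_tuple_take s (n - s) h q1; rewrite subnKC. Qed.

Lemma sum_ffun_marginal3 (I T U V : finType) (c e : T -> U -> V -> R) (k : I) :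
  \sum_t \sum_u \sum_v c t u v = 1 ->
  \sum_(f : {ffun I -> T}) \sum_(g : {ffun I -> U}) \sum_(h : {ffun I -> V})
     (\prod_i c (f i) (g i) (h i)) * e (f k) (g k) (h k) =
  \sum_t \sum_u \sum_v c t u v * e t u v.
Proof.
move=> c1; transitivity (\sum_(f : {ffun I -> T}) \sum_(g : {ffun I -> U})
  \sum_(h : {ffun I -> V}) \prod_i (c (f i) (g i) (h i) *
     (if i == k then e (f i) (g i) (h i) else 1))).
  apply: eq_bigr => f _; apply: eq_bigr => g _; apply: eq_bigr => h _.
  rewrite big_split /=; congr (_ * _); rewrite -[LHS](prod_if_eq k).
  by apply: eq_bigr => i _; case: eqP => // ->.
rewrite (sum_ffun_prod3 (fun i t u v => c t u v * (if i == k then e t u v else 1))).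
rewrite (bigD1 k) //= eqxx [X in _ * X]big1 ?mulr1 // => i /negPf ->.
rewrite -[RHS]c1; do 3 (apply: eq_bigr => ? _); by rewrite mulr1.
Qed.

Lemma sum_ffun_prod2 (I T U : finType) (c : I -> T -> U -> R) :
  \sum_(f : {ffun I -> T}) \sum_(g : {ffun I -> U}) \prod_i c i (f i) (g i) =
  \prod_i \sum_t \sum_u c i t u.
Proof.
by rewrite bigA_distr_bigA; apply: eq_bigr => f _; rewrite bigA_distr_bigA.
Qed.

Lemma sum_tuple_nth (T : finType) (q h : T -> R) (x0 : T) n k :
  (k < n)%N -> \sum_t q t = 1 ->
  \sum_(z : n.-tuple T) (\prod_(c <- z) q c) * h (nth x0 z k) = \sum_t q t * h t.
Proof.
move=> kn q1; elim: n k kn => [//|n IH] [|k] kn; rewrite sum_tupleS.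
  apply: eq_bigr => x _; rewrite -[RHS]mulr1 -[X in _ = _ * X](sum_tuple_prod1 n q1) mulr_sumr.
  by apply: eq_bigr => z _ /=; rewrite big_cons mulrAC.
transitivity (\sum_x q x * \sum_t q t * h t); last by rewrite -mulr_suml q1 mul1r.
apply: eq_bigr => x _; rewrite -(IH k) // mulr_sumr.
by apply: eq_bigr => z _ /=; rewrite big_cons mulrA.
Qed.

End FiniteSums.

(** * Random permutations, Gibbs variational inequality, Chernoff exponents *)

Section Inequalities.
Variable R : realType.

Lemma partial_sum_expR (x : R) n : 0 <= x ->
  \sum_(k < n) x ^+ k / k`!%:R <= expR x.
Proof.
move=> x0; rewrite -(big_mkord xpredT (fun k => x ^+ k / k`!%:R)).
apply: (nondecreasing_cvgn_le (u_ := series (exp_coeff x))).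
  apply: nondecreasing_series => k _ _; exact: exp_coeff_ge0.
exact: is_cvg_series_exp_coeff.
Qed.

(** Fixing [J] pointwise means being supported in its complement. *)
Lemma card_perm_fixing m (J : {set 'I_m}) :
  #|[set s : {perm 'I_m} | J \subset [set i | s i == i]]| = (m - #|J|)`!.
Proof.
have -> : (m - #|J|)%N = #|~: J| by rewrite [RHS]cardsCs finset.setCK card_ord.
rewrite -(card_perm (~: J)); apply: eq_card => s; rewrite !inE.
apply/fintype.subsetP/fintype.subsetP => H i.
  rewrite !inE; apply: contra => iJ.
  by have := H i iJ; rewrite inE.
move=> iJ; rewrite inE; apply/negPn/negP => si.
by have := H i si; rewrite inE iJ.
Qed.

(** Expanding [a = (a - 1) + 1] over the fixed points gives a sum over the sets [J] of fixed points
    of [(a - 1) ^+ #|J|]. Grouping by [k = #|J|], the [k]-th group is [m! (a - 1)^k / k!], and the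
    exponential series bounds the total: fixed points are dominated by a Poisson variable of mean
    1. *)
Lemma sum_perm_exp_fix m (a : R) : 1 <= a ->
  \sum_(s : {perm 'I_m}) a ^+ #|[set i | s i == i]| <= m`!%:R * expR (a - 1).
Proof.
move=> a1.
have E (s : {perm 'I_m}) : a ^+ #|[set i | s i == i]| =
    \sum_(J : {set 'I_m} | J \subset [set i | s i == i]) (a - 1) ^+ #|J|.
  transitivity (\prod_(i < m) ((if s i == i then a - 1 else 0) + 1)).
    rewrite -prodr_const big_mkcond /=; apply: eq_bigr => i _.
    by rewrite inE; case: ifP; rewrite ?subrK ?add0r.
  rewrite bigA_distr [RHS]big_mkcond; apply: eq_bigr => J _ /=.
  rewrite -big_mkcond /=; case: ifPn => [/fintype.subsetP H|].
    rewrite -prodr_const; apply: eq_bigr => i iJ.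
    by have := H i iJ; rewrite inE => ->.
  case/subsetPn => i iJ; rewrite inE => /negPf ni.
  by rewrite (bigD1 i) //= ni mul0r.
rewrite (eq_bigr _ (fun s _ => E s)) (exchange_big_dep xpredT) //=.
have -> : \sum_(J : {set 'I_m}) \sum_(s : {perm 'I_m} | J \subset [set i | s i == i])
    (a - 1) ^+ #|J| = \sum_(J : {set 'I_m}) (m - #|J|)`!%:R * (a - 1) ^+ #|J|.
  apply: eq_bigr => J _; rewrite -card_perm_fixing mulr_natl -sumr_const.
  by apply: eq_bigl => s; rewrite inE.
rewrite (partition_big (fun J : {set 'I_m} => inord #|J| : 'I_m.+1) xpredT) //=.
apply: le_trans (ler_wpM2l (ler0n _ _) (partial_sum_expR m.+1 _)); last first.
  by rewrite subr_ge0.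
rewrite mulr_sumr; apply: ler_sum => k _.
rewrite (eq_bigl (fun J : {set 'I_m} => J \in [set J : {set 'I_m} | #|J| == k])).
  rewrite (eq_bigr (fun=> (m - k)`!%:R * (a - 1) ^+ k)); last first.
    by move=> J; rewrite inE => /eqP ->.
  rewrite sumr_const card_draws card_ord -mulr_natl.
  have km : (k <= m)%N by rewrite -ltnS.
  rewrite -(bin_fact km) !natrM le_eqVlt; apply/orP; left; apply/eqP.
  have k0 : k`!%:R != 0 :> R by rewrite pnatr_eq0 -lt0n fact_gt0.
  by field.
move=> J; rewrite inE -val_eqE /= inordK // ltnS -[leqRHS]card_ord.
exact: max_card.
Qed.

(** After right translation by [s0], agreements with [s0] become fixed points. *)
Lemma sum_perm_exp_agree m (s0 : {perm 'I_m}) (a : R) : 1 <= a ->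
  \sum_(s : {perm 'I_m}) a ^+ #|[set i | s i == s0 i]| <= m`!%:R * expR (a - 1).
Proof.
move=> a1; apply: le_trans (sum_perm_exp_fix m a1).
rewrite (reindex_inj (mulIg s0)) /=; apply: ler_sum => s _.
rewrite le_eqVlt; apply/orP; left; apply/eqP; congr (_ ^+ _).
by apply: eq_card => i; rewrite !inE permM (inj_eq perm_inj).
Qed.

(** With [L] the density of [p] against a second measure, the hypothesis bounds the exponential
    moment of [g] under that measure, and the conclusion bounds the mean of [g] under [p] minus the
    relative entropy. Both come from [1 + x <= expR x] at [x = g - ln L - c]. *)
Lemma gibbs_variational (T : finType) (p L g : T -> R) (c : R) :
  (forall t, 0 <= p t) -> \sum_t p t = 1 ->
  (forall t, 0 < p t -> 0 < L t) ->
  \sum_t p t * (expR (g t) / L t) <= expR c ->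
  \sum_t p t * (g t - ln (L t)) <= c.
Proof.
move=> p0 p1 L0 H.
have : \sum_t p t * (g t - ln (L t) - c) <=
    (\sum_t p t * (expR (g t) / L t)) / expR c - 1.
  rewrite -[X in _ - X]p1 mulr_suml -sumrB; apply: ler_sum => t _.
  have [->|pt] := eqVneq (p t) 0; first by rewrite !mul0r subrr.
  have pt0 : 0 < p t by rewrite lt_neqAle eq_sym pt p0.
  rewrite -mulrA -[X in _ <= _ - X]mulr1 -mulrBr ler_wpM2l // lerBrDl.
  have := expR_ge1Dx (g t - ln (L t) - c).
  by rewrite !expRB lnK // posrE L0.
have : (\sum_t p t * (expR (g t) / L t)) / expR c <= 1.
  by rewrite ler_pdivrMr ?expR_gt0 // mul1r.
have -> : \sum_t p t * (g t - ln (L t) - c) = (\sum_t p t * (g t - ln (L t))) - c.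
  under eq_bigr do rewrite mulrBr.
  by rewrite sumrB -mulr_suml p1 mul1r.
lra.
Qed.

(** From [1 - u <= expR (- u)] one gets [expR u <= 1 / (1 - u)], and [(1 - u) (1 + u + 2 u^2) = 1 +
    u^2 (1 - 2 u)] is at least 1. *)
Lemma expR_le_quadratic (u : R) : u <= 2^-1 -> expR u <= 1 + u + 2 * u ^+ 2.
Proof.
move=> u2; have := expR_ge1Dx (- u); rewrite expRN => H.
have e0 := expR_gt0 u.
have : (1 - u) * expR u <= 1.
  by rewrite -ler_pdivlMr // div1r.
have : 1 <= (1 - u) * (1 + u + 2 * u ^+ 2).
  have : 0 <= u ^+ 2 * (1 - 2 * u) by rewrite mulr_ge0 ?sqr_ge0 //; lra.
  lra.
move=> h1 h2; rewrite -(ler_pM2l (_ : 0 < 1 - u)); last lra.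
exact: le_trans h2 h1.
Qed.

(** As a function of [r] the exponential moment is 1 at 0 with negative slope there, so it drops
    below 1 for small positive [r]. *)
Lemma chernoff_exponent (T : finType) (p f : T -> R) (c : R) :
  (forall t, 0 <= p t) -> \sum_t p t = 1 -> c < \sum_t p t * f t ->
  exists2 r, 0 < r & \sum_t p t * expR (r * (c - f t)) < 1.
Proof.
move=> p0 p1 cf.
set d := \sum_t p t * f t - c; have d0 : 0 < d by rewrite subr_gt0.
set M := 1 + \sum_t `|c - f t|.
have M1 : 1 <= M by rewrite lerDl sumr_ge0.
have fM t : `|c - f t| <= M.
  by rewrite /M (bigD1 t) //= addrCA lerDl addr_ge0 // sumr_ge0.
have M0 : 0 < M by lra.
(* The first bound keeps [r * (c - f t)] below 1/2, where the quadratic estimate applies; the second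
   makes the quadratic term at most half of the linear gain [r * d]. *)
pose r := Num.min (2 * M)^-1 (d / (4 * M ^+ 2)).
have r0 : 0 < r.
  by rewrite lt_min invr_gt0 mulr_gt0 //= divr_gt0 // mulr_gt0 // exprn_gt0.
have rM : r * M <= 2^-1.
  have H : r <= (2 * M)^-1 by rewrite ge_min lexx.
  apply: le_trans (ler_wpM2r (ltW M0) H) _.
  by rewrite invfM -mulrA mulVf ?mulr1 // lt0r_neq0.
have rd : 4 * r * M ^+ 2 <= d.
  have : r <= d / (4 * M ^+ 2) by rewrite ge_min lexx orbT.
  by rewrite ler_pdivlMr ?mulr_gt0 ?exprn_gt0 // => H; apply: le_trans _ H; lra.
exists r => //.
apply: (@le_lt_trans _ _ (\sum_t p t * (1 + r * (c - f t) + 2 * (r * M) ^+ 2))).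
  apply: ler_sum => t _; rewrite ler_wpM2l //.
  have := fM t; rewrite ler_norml => /andP[l1 l2].
  have u2 : r * (c - f t) <= 2^-1.
    by apply: le_trans rM; rewrite ler_pM2l.
  apply: le_trans (expR_le_quadratic u2) _; rewrite lerD2l ler_wpM2l //.
  rewrite -[leLHS]ger0_norm ?sqr_ge0 // normrX ler_sqr ?nnegrE //; last first.
    by rewrite mulr_ge0 // ltW.
  by rewrite normrM gtr0_norm // ler_pM2l.
have -> : \sum_t p t * (1 + r * (c - f t) + 2 * (r * M) ^+ 2) =
    1 - r * d + 2 * (r * M) ^+ 2.
  transitivity (\sum_t (p t * (1 + r * c + 2 * (r * M) ^+ 2) - r * (p t * f t))).
    by apply: eq_bigr => t _; ring.
  by rewrite sumrB -mulr_suml -mulr_sumr p1 /d; ring.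
nra.
Qed.

Lemma prodr_gt0_factor (I : finType) (F : I -> R) (i : I) :
  (forall j, 0 <= F j) -> 0 < \prod_j F j -> 0 < F i.
Proof.
move=> F0 H; rewrite lt_neqAle F0 andbT eq_sym; apply: contraTneq H => Fi.
by rewrite (bigD1 i) //= Fi mul0r ltxx.
Qed.

Lemma ln_prodr (I : finType) (F : I -> R) :
  (forall i, 0 < F i) -> \sum_i ln (F i) = ln (\prod_i F i).
Proof.
move=> F0; suff [] : \sum_i ln (F i) = ln (\prod_i F i) /\ 0 < \prod_i F i by [].
elim/big_rec2: _ => [|i x y _ [-> y0]]; first by rewrite ln1.
by rewrite lnM ?posrE // mulr_gt0.
Qed.

End Inequalities.

(** * One-shot bounds *)

(** A permutation containing the most unambiguous pairs contains them all. Threshold tests yield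
    only a relation, whereas a decoder must return a permutation. *)
Lemma unique_match_perm m (M : 'I_m -> 'I_m -> bool) :
  exists s : {perm 'I_m}, forall i l,
    M i l -> (forall l', M i l' -> l' = l) -> (forall i', M i' l -> i' = i) ->
    s i = l.
Proof.
pose U i l := [&& M i l, [forall l', M i l' ==> (l' == l)] &
                  [forall i', M i' l ==> (i' == i)]].
pose N (s : {perm 'I_m}) := #|[set i | U i (s i)]|.
have [s _ smax] : exists2 s : {perm 'I_m}, true & forall s', (N s' <= N s)%N.
  by case: (@arg_maxnP _ (1%g : {perm 'I_m}) xpredT N) => // s _ H; exists s => // s'; apply: H.
exists s => i l Mil rowU colU.
have Uil : U i l.
  rewrite /U Mil /=; apply/andP; split; apply/forallP => j; apply/implyP => H.
    by rewrite (rowU _ H).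
  by rewrite (colU _ H).
apply/eqP/negPn/negP => sil.
(* Swapping the images of i and s^-1 l gains the match (i, l) and loses none. *)
pose s' := (s * tperm (s i) l)%g.
have s'i : s' i = l by rewrite permM tpermL.
have := smax s'; rewrite leqNgt => /negP; apply.
rewrite /N; apply: proper_card; apply/properP; split; last first.
  exists i; rewrite !inE ?s'i //.
  apply/negP => /and3P[H _ _]; by rewrite (rowU _ H) eqxx in sil.
apply/fintype.subsetP => k; rewrite !inE => Uk.
rewrite permM; case: tpermP => [/perm_inj ki|skl|] //; first by rewrite ki.
by move: Uk; rewrite skl => /and3P[/colU ki _ _]; rewrite ki in skl; rewrite skl eqxx in sil.
Qed.

Section OneShot.
Variable R : realType.
Variables A N P : finType.
Variables (a : A -> R) (w : A -> N -> R) (p : P -> R).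
Hypotheses (a0 : forall x, 0 <= a x) (a1 : \sum_x a x = 1).
Hypotheses (w0 : forall x z, 0 <= w x z) (w1 : forall x, \sum_z w x z = 1).
Hypotheses (p0 : forall S, 0 <= p S) (p1 : \sum_S p S = 1).
Variables m B : nat.

(** A whole row counts as one letter of [A], its noise as one element of [N], and a repetition
    pattern as one element of [P], so the bounds of this section ignore the column structure. *)
Definition outcome : Type :=
  ({ffun 'I_m -> A} * P * {perm 'I_m} * {ffun 'I_m -> N} *
   {ffun 'I_B -> A} * {ffun 'I_B -> N})%type.
Definition rows (o : outcome) := o.1.1.1.1.1.
Definition patt (o : outcome) := o.1.1.1.1.2.
Definition relab (o : outcome) := o.1.1.1.2.
Definition noises (o : outcome) := o.1.1.2.
Definition seeds (o : outcome) := o.1.2.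
Definition seed_noises (o : outcome) := o.2.

Definition prob (o : outcome) : R :=
  (\prod_i a (rows o i)) * p (patt o) * (m`!%:R)^-1 *
  (\prod_i w (rows o ((relab o)^-1%g i)) (noises o i)) *
  (\prod_b a (seeds o b)) * (\prod_b w (seeds o b) (seed_noises o b)).

Definition mean (F : outcome -> R) : R := \sum_(o : outcome) prob o * F o.

Lemma prob_ge0 o : 0 <= prob o.
Proof. by rewrite /prob !mulr_ge0 ?prodr_ge0 // invr_ge0. Qed.

Lemma mean_sums F : mean F =
  \sum_(D : {ffun 'I_m -> A}) \sum_S \sum_(t : {perm 'I_m})
  \sum_(Z : {ffun 'I_m -> N}) \sum_(G : {ffun 'I_B -> A})
  \sum_(W : {ffun 'I_B -> N}) prob (D, S, t, Z, G, W) * F (D, S, t, Z, G, W).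
Proof.
by rewrite !pair_bigA /=; apply: eq_bigr => o _; rewrite -!surjective_pairing.
Qed.

(** In this nested form, variables on which [F] does not depend are summed out from the inside. *)
Lemma mean_expand F : mean F =
  \sum_S p S * \sum_(t : {perm 'I_m}) (m`!%:R)^-1 *
  \sum_(D : {ffun 'I_m -> A}) (\prod_i a (D i)) *
  \sum_(Z : {ffun 'I_m -> N}) (\prod_i w (D (t^-1%g i)) (Z i)) *
  \sum_(G : {ffun 'I_B -> A}) (\prod_b a (G b)) *
  \sum_(W : {ffun 'I_B -> N}) (\prod_b w (G b) (W b)) * F (D, S, t, Z, G, W).
Proof.
rewrite mean_sums exchange_big; apply: eq_bigr => S _ /=.
rewrite exchange_big mulr_sumr; apply: eq_bigr => t _ /=.
rewrite !mulr_sumr; apply: eq_bigr => D _.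
rewrite !mulr_sumr; apply: eq_bigr => Z _.
rewrite !mulr_sumr; apply: eq_bigr => G _.
rewrite !mulr_sumr; apply: eq_bigr => W _.
rewrite /prob /rows /patt /relab /noises /seeds /seed_noises /=; ring.
Qed.

Lemma sum_rows1 k : \sum_(D : {ffun 'I_k -> A}) \prod_i a (D i) = 1.
Proof. exact: (sum_ffun_prod_pmf (q := fun=> a)). Qed.

Lemma sum_noises1 k (D : 'I_k -> A) :
  \sum_(Z : {ffun 'I_k -> N}) \prod_i w (D i) (Z i) = 1.
Proof. exact: (sum_ffun_prod_pmf (q := fun i => w (D i))). Qed.

Lemma sum_relab (c : R) : \sum_(t : {perm 'I_m}) (m`!%:R)^-1 * c = c.
Proof.
rewrite sumr_const card_Sn -mulrnAl -mulr_natl mulfV ?mul1r //.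
Qed.

Lemma mean_seed (h : P -> {ffun 'I_B -> A} -> {ffun 'I_B -> N} -> R) :
  mean (fun o => h (patt o) (seeds o) (seed_noises o)) =
  \sum_S p S * \sum_(G : {ffun 'I_B -> A}) (\prod_b a (G b)) *
    \sum_(W : {ffun 'I_B -> N}) (\prod_b w (G b) (W b)) * h S G W.
Proof.
rewrite mean_expand /patt /seeds /seed_noises /=.
apply: eq_bigr => S _; congr (_ * _).
rewrite -[RHS]sum_relab; apply: eq_bigr => t _; congr (_ * _).
under eq_bigr => D _ do rewrite -mulr_suml (sum_noises1 (D \o t^-1%g)) mul1r.
by rewrite -mulr_suml sum_rows1 mul1r.
Qed.

Lemma mean_rows (h : P -> {perm 'I_m} -> {ffun 'I_m -> A} -> {ffun 'I_m -> N} -> R) :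
  mean (fun o => h (patt o) (relab o) (rows o) (noises o)) =
  \sum_S p S * \sum_(t : {perm 'I_m}) (m`!%:R)^-1 *
  \sum_(D : {ffun 'I_m -> A}) (\prod_i a (D i)) *
  \sum_(Z : {ffun 'I_m -> N}) (\prod_i w (D (t^-1%g i)) (Z i)) * h S t D Z.
Proof.
rewrite mean_expand /patt /relab /rows /noises /=.
do 2 (apply: eq_bigr => ? _; congr (_ * _)).
do 2 (apply: eq_bigr => ? _; congr (_ * _)).
under eq_bigr => G _ do rewrite -mulr_suml sum_noises1 mul1r.
by rewrite -mulr_suml sum_rows1 mul1r.
Qed.

Lemma mean_cst (c : R) : mean (fun=> c) = c.
Proof.
rewrite (mean_seed (fun _ _ _ => c)).
under eq_bigr => S _.
  under eq_bigr => G _ do rewrite -mulr_suml sum_noises1 mul1r.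
  rewrite -mulr_suml sum_rows1 mul1r; over.
by rewrite -mulr_suml p1 mul1r.
Qed.

Lemma prob_sum1 : \sum_o prob o = 1.
Proof. by rewrite -[RHS](mean_cst 1); apply: eq_bigr => o _; rewrite mulr1. Qed.

Lemma mean_matched (i : 'I_m) (h : P -> A -> N -> R) :
  mean (fun o => h (patt o) (rows o i) (noises o (relab o i))) =
  \sum_S p S * \sum_x a x * \sum_z w x z * h S x z.
Proof.
rewrite (mean_rows (fun S t D Z => h S (D i) (Z (t i)))).
apply: eq_bigr => S _; congr (_ * _).
rewrite -[RHS]sum_relab; apply: eq_bigr => t _; congr (_ * _).
under eq_bigr => D _.
  rewrite (sum_ffun_marginal (q := fun j => w (D (t^-1%g j))) (t i) (h S (D i))) //.
  rewrite permK; over.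
exact: (sum_ffun_marginal (q := fun=> a) i (fun x => \sum_z w x z * h S x z)).
Qed.

(** The labeled row at [relab o k] is generated from row [k], which is independent of row [i]. *)
Lemma mean_mismatched (i k : 'I_m) (h : P -> A -> N -> R) : i != k ->
  mean (fun o => h (patt o) (rows o i) (noises o (relab o k))) =
  \sum_S p S * \sum_x a x * \sum_y a y * \sum_z w y z * h S x z.
Proof.
move=> ik; rewrite (mean_rows (fun S t D Z => h S (D i) (Z (t k)))).
apply: eq_bigr => S _; congr (_ * _).
rewrite -[RHS]sum_relab; apply: eq_bigr => t _; congr (_ * _).
under eq_bigr => D _.
  rewrite (sum_ffun_marginal (q := fun j => w (D (t^-1%g j))) (t k) (h S (D i))) //.
  rewrite permK; over.
exact: (sum_ffun_marginal2 (q := fun=> a) (fun x y => \sum_z w y z * h S x z)).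
Qed.

Lemma mean_le F G : (forall o, 0 < prob o -> F o <= G o) -> mean F <= mean G.
Proof.
move=> H; apply: ler_sum => o _.
have [->|po] := eqVneq (prob o) 0; first by rewrite !mul0r.
by rewrite ler_wpM2l ?prob_ge0 // H // lt_neqAle eq_sym po prob_ge0.
Qed.

Lemma mean_ge0 F : (forall o, 0 <= F o) -> 0 <= mean F.
Proof. by move=> H; apply: sumr_ge0 => o _; rewrite mulr_ge0 ?prob_ge0. Qed.

Lemma meanD F G : mean (fun o => F o + G o) = mean F + mean G.
Proof. by rewrite -big_split; apply: eq_bigr => o _; rewrite mulrDr. Qed.

Lemma meanZ c F : mean (fun o => c * F o) = c * mean F.
Proof. by rewrite mulr_sumr; apply: eq_bigr => o _; rewrite mulrCA. Qed.

Lemma mean_sum (I : finType) (Q : pred I) (F : I -> outcome -> R) :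
  mean (fun o => \sum_(i | Q i) F i o) = \sum_(i | Q i) mean (F i).
Proof. by rewrite exchange_big; apply: eq_bigr => o _; rewrite mulr_sumr. Qed.

Definition decoder (O : Type) :=
  {ffun 'I_m -> A} -> ('I_m -> O) -> {ffun 'I_B -> A} -> ('I_B -> O) -> {perm 'I_m}.

Definition decode (O : Type) (obs : P -> N -> O) (phi : decoder O) (o : outcome) :=
  phi (rows o) (fun i => obs (patt o) (noises o i)) (seeds o)
      (fun b => obs (patt o) (seed_noises o b)).

Definition wrong (O : Type) (obs : P -> N -> O) (phi : decoder O) (o : outcome) :=
  #|[set i : 'I_m | relab o i != decode obs phi o i]|.

Definition error (O : Type) (obs : P -> N -> O) (phi : decoder O) : R :=
  mean (fun o => (wrong obs phi o)%:R / m%:R).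

(** * Threshold decoding with an estimated pattern *)

Section Direct.
Variables (O : Type) (obs : P -> N -> O) (score : P -> A -> O -> R).
Hypothesis score0 : forall S x y, 0 <= score S x y.
Hypothesis score_mean : forall S y, \sum_x a x * score S x y <= 1.
Variable est : {ffun 'I_B -> A} -> ('I_B -> O) -> P.
Variable tau : R.
Hypothesis tau0 : 0 < tau.

(** The three terms bound a true pair scoring below [tau], a false pair passing in the same row or
    column of the match relation, and a wrong pattern estimate. *)
Lemma direct_bound : (0 < m)%N -> exists phi : decoder O, error obs phi <=
  (\sum_S p S * \sum_x a x * \sum_z w x z * (score S x (obs S z) < tau)%R%:R) +
  2 * m%:R / tau +
  \sum_S p S * \sum_(G : {ffun 'I_B -> A}) (\prod_b a (G b)) *
    \sum_(W : {ffun 'I_B -> N}) (\prod_b w (G b) (W b)) *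
      (est G (fun b => obs S (W b)) != S)%:R.
Proof.
move=> m0.
pose pass S x y := tau <= score S x y.
pose M (D1 : {ffun 'I_m -> A}) (D2 : 'I_m -> O) S i l := pass S (D1 i) (D2 l).
exists (fun D1 D2 G1 G2 =>
  projT1 (cid (unique_match_perm (M D1 D2 (est G1 G2))))).
set phi := (fun _ _ _ _ => _).
have m0R : (0 : R) < m%:R by rewrite ltr0n.
pose bad o := est (seeds o) (fun b => obs (patt o) (seed_noises o b)) != patt o.
pose miss i o := score (patt o) (rows o i) (obs (patt o) (noises o (relab o i))) < tau.
pose false_pass i k o := pass (patt o) (rows o i) (obs (patt o) (noises o (relab o k))).
(* Pointwise union bound: with the right pattern, a true pair that passes and meets no false pass in
   its row or column is unambiguous, hence decoded correctly. A wrong pattern costs at most 1. *)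
apply: (@le_trans _ _ (mean (fun o => m%:R^-1 * (\sum_i ((miss i o)%:R +
     (\sum_(k | k != i) ((false_pass i k o)%:R + (false_pass k i o)%:R)))) + (bad o)%:R))).
  apply: mean_le => o _.
  have cnt0 i : 0 <= \sum_(k | k != i) ((false_pass i k o)%:R + (false_pass k i o)%:R) :> R.
    by apply: sumr_ge0 => k _; rewrite addr_ge0.
  case bo : (bad o).
    rewrite ler_wpDl //.
      rewrite mulr_ge0 ?invr_ge0 // sumr_ge0 // => i _.
      by rewrite addr_ge0.
    by rewrite ler_pdivrMr // mul1r ler_nat -[leqRHS]card_ord max_card.
  rewrite addr0 mulrC ler_pM2l ?invr_gt0 //.
  rewrite /wrong -sum1_card natr_sum big_mkcond /=; apply: ler_sum => i _.
  rewrite inE; case: ifPn => // [|_]; last by rewrite addr_ge0.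
  apply: contraNT; rewrite -ltNge => small.
  have fp0 k : k != i -> (false_pass i k o = false) * (false_pass k i o = false).
    move=> ki; move: small; rewrite (bigD1 k) //=.
    have c0 : 0 <= \sum_(j | (j != i) && (j != k))
       ((false_pass i j o)%:R + (false_pass j i o)%:R) :> R.
      by apply: sumr_ge0 => j _; rewrite addr_ge0.
    by case: (false_pass i k o) (false_pass k i o) (miss i o) => [] [] [] //=; lra.
  have nm : miss i o = false.
    by move: small; have := cnt0 i; case: (miss i o) => //=; lra.
  have eS : est (seeds o) (fun b => obs (patt o) (seed_noises o b)) = patt o.
    by apply/eqP; move: bo; rewrite /bad => /negbFE.
  rewrite eq_sym; apply/eqP; rewrite /decode /phi; case: cid => s /= Hs; apply: Hs.
  - by rewrite eS /M /pass leNgt -/(miss i o) nm.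
  - move=> l'; rewrite eS => Ml'; apply/eqP.
    rewrite -(permKV (relab o) l') (inj_eq perm_inj); apply/negPn/negP => /fp0[+ _].
    by rewrite /false_pass permKV [pass _ _ _]Ml'.
  - move=> i'; rewrite eS => Mi'; apply/eqP/negPn/negP => /fp0[_].
    by rewrite /false_pass [pass _ _ _]Mi'.
rewrite meanD meanZ mean_sum.
(* Markov's inequality: row [i] is independent of the labeled row, and for every fixed observation
   the score has mean at most 1. *)
have fpm i k : i != k -> mean (fun o => (false_pass i k o)%:R) <= tau^-1.
  move=> ik; rewrite (mean_mismatched (fun S x z => (pass S x (obs S z))%:R) ik).
  apply: (@le_trans _ _ (\sum_S p S * tau^-1)); last by rewrite -mulr_suml p1 mul1r.
  apply: ler_sum => S _; rewrite ler_wpM2l //.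
  under eq_bigr do rewrite mulr_sumr.
  rewrite exchange_big /=.
  apply: (@le_trans _ _ (\sum_y a y * tau^-1)); last by rewrite -mulr_suml a1 mul1r.
  apply: ler_sum => y _; under eq_bigr do rewrite mulrCA.
  rewrite -mulr_sumr ler_wpM2l //.
  under eq_bigr do rewrite mulr_sumr.
  rewrite exchange_big /=.
  apply: (@le_trans _ _ (\sum_z w y z * tau^-1)); last by rewrite -mulr_suml w1 mul1r.
  apply: ler_sum => z _; under eq_bigr do rewrite mulrCA.
  rewrite -mulr_sumr ler_wpM2l // -[leRHS]mul1r ler_pdivlMr //.
  apply: le_trans (score_mean S (obs S z)); rewrite mulr_suml.
  apply: ler_sum => x _; rewrite -mulrA ler_wpM2l // /pass.
  by case: (boolP (tau <= _)) => ?; rewrite ?mul1r ?mul0r.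
rewrite lerD //; last first.
  by rewrite (mean_seed (fun S G W => (est G (fun b => obs S (W b)) != S)%:R)).
rewrite mulrC ler_pdivrMr //.
set E1 := \sum_S p S * _.
have -> : (E1 + 2 * m%:R / tau) * m%:R =
    \sum_(i < m) (E1 + \sum_(k < m) (tau^-1 + tau^-1)).
  rewrite !sumr_const !card_ord -[RHS]mulr_natr -[X in _ = (_ + X) * _]mulr_natr.
  by ring.
apply: ler_sum => i _; rewrite meanD.
rewrite (mean_matched i (fun S x z => (score S x (obs S z) < tau)%R%:R)) lerD2l.
rewrite mean_sum big_mkcond /=; apply: ler_sum => k _.
case: ifPn => ki; last by rewrite addr_ge0 // invr_ge0 ltW.
by rewrite meanD lerD // fpm // eq_sym.
Qed.

End Direct.

(** * Converse by change of measure *)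

Section Converse.
(** The observation type [O] may be infinite, so observations factor through a finite [Y]. The
    hypotheses say that dividing the noise law by [L] leaves an image on [Y] dominated by [Q S],
    whatever the row [x]. *)
Variables (Y : finType) (O : Type) (proj : P -> N -> Y) (read : Y -> O).
Variables (L : P -> A -> N -> R) (Q : P -> Y -> R).
Hypothesis L_ge0 : forall S x z, 0 <= L S x z.
Hypothesis L_gt0 : forall S x z, 0 < a x -> 0 < w x z -> 0 < L S x z.
Hypothesis LQ : forall S x y, \sum_(z | proj S z == y) w x z / L S x z <= Q S y.
Hypothesis Q1 : forall S, \sum_y Q S y <= 1.

Lemma Q_ge0 (x0 : A) S y : 0 <= Q S y.
Proof.
by apply: le_trans (LQ S x0 y); apply: sumr_ge0 => z _; rewrite divr_ge0.
Qed.

Definition joint_ratio o :=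
  \prod_i L (patt o) (rows o ((relab o)^-1%g i)) (noises o i).

Definition agreement (phi : decoder O) o :=
  #|[set i | relab o i == decode (fun S z => read (proj S z)) phi o i]|.

(* Dividing by [joint_ratio] turns the noisy rows into rows independent of the
   relabelling, which can then be averaged out first. *)
Lemma mean_agreement_ratio (phi : decoder O) : (0 < m)%N ->
  mean (fun o => m%:R ^+ agreement phi o / joint_ratio o) <= expR (m%:R - 1).
Proof.
move=> m0; set c := expR _.
have c0 : 0 <= c by apply: expR_ge0.
rewrite mean_expand -[leRHS]mul1r -[X in _ <= X * _]p1 mulr_suml; apply: ler_sum => S _.
rewrite ler_wpM2l //; rewrite -mulr_sumr.
rewrite ler_pdivrMl ?ltr0n ?fact_gt0 //.
rewrite exchange_big /= -[leRHS]mul1r -[X in _ <= X * _](sum_rows1 m) mulr_suml.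
apply: ler_sum => D _; rewrite -mulr_sumr ler_wpM2l ?prodr_ge0 //.
pose x0 := D (Ordinal m0).
have Qm (y : {ffun 'I_m -> Y}) : 0 <= \prod_i Q S (y i).
  by apply: prodr_ge0 => i _; apply: (Q_ge0 x0).
pose F t (y : {ffun 'I_m -> Y}) G W : R := m%:R ^+ #|[set i | t i ==
   phi D (fun i => read (y i)) G (fun b : 'I_B => read (proj S (W b))) i]|.
pose H t (y : {ffun 'I_m -> Y}) : R := \sum_(G : {ffun 'I_B -> A}) (\prod_b a (G b)) *
  \sum_(W : {ffun 'I_B -> N}) (\prod_b w (G b) (W b)) * F t y G (W : {ffun 'I_B -> N}).
have F0 t y G W : 0 <= F t y G W by rewrite exprn_ge0.
have H0 t y : 0 <= H t y.
  by apply: sumr_ge0 => G _; rewrite mulr_ge0 ?prodr_ge0 // sumr_ge0 // => W _;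
     rewrite mulr_ge0 ?prodr_ge0.
(* Change of measure: the weights [w / L] are pushed to [Y] and bounded by [Q], which no longer
   involves the relabelling [t]. *)
apply: (@le_trans _ _ (\sum_(t : {perm 'I_m}) \sum_(y : {ffun 'I_m -> Y})
   (\prod_i Q S (y i)) * H t y)).
  apply: ler_sum => t _.
  pose v i z := w (D (t^-1%g i)) z / L S (D (t^-1%g i)) z.
  apply: (@le_trans _ _ (\sum_(Z : {ffun 'I_m -> N}) (\prod_i v i (Z i)) *
      H t [ffun i => proj S (Z i)])).
    rewrite le_eqVlt; apply/orP; left; apply/eqP; apply: eq_bigr => Z _.
    rewrite /v big_split /= -mulrA; congr (_ * _).
    rewrite mulr_sumr; apply: eq_bigr => G _.
    rewrite mulrCA; congr (_ * _); rewrite mulr_sumr; apply: eq_bigr => W _.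
    rewrite [RHS]mulrCA; congr (_ * _); rewrite mulrC /joint_ratio -prodfV; congr (_ * _).
    rewrite /F /agreement /decode /rows /relab /seeds /seed_noises /patt /noises /=.
    congr (_ ^+ _); apply: eq_card => i; rewrite !inE; congr (_ == fun_of_perm (phi D _ G _) i).
    by apply: funext => k; rewrite ffunE.
  rewrite (sum_ffun_push v (fun=> proj S) (H t)); apply: ler_sum => y _.
  rewrite ler_wpM2r //; apply: ler_prod => i _; rewrite LQ andbT.
  by apply: sumr_ge0 => z _; rewrite divr_ge0.
rewrite exchange_big /=.
apply: (@le_trans _ _ (\sum_(y : {ffun 'I_m -> Y}) (\prod_i Q S (y i)) * (m`!%:R * c))).
  apply: ler_sum => y _; rewrite -mulr_sumr ler_wpM2l //.
  rewrite exchange_big /= -[leRHS]mul1r -[X in _ <= X * _](sum_rows1 B) mulr_suml.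
  apply: ler_sum => G _; rewrite -mulr_sumr ler_wpM2l ?prodr_ge0 //.
  rewrite exchange_big /= -[leRHS]mul1r -[X in _ <= X * _](sum_noises1 G) mulr_suml.
  apply: ler_sum => W _; rewrite -mulr_sumr ler_wpM2l ?prodr_ge0 //.
  (* With rows, observations and seeds fixed, the decoder's answer is one permutation independent of
     [t]. *)
  by apply: sum_perm_exp_agree; rewrite ler1n.
rewrite -mulr_suml ler_piMl ?mulr_ge0 //.
rewrite (sum_ffun_prod (fun _ => Q S)) prodr_ile1 // => i _.
rewrite Q1 andbT sumr_ge0 // => y _; apply: (Q_ge0 x0).
Qed.

(** The mean number of agreements is [m (1 - error)] and the mean of [ln joint_ratio] is [m] times
    the information of one pair; the variational inequality is then divided by [m]. *)
Lemma converse_bound (phi : decoder O) : (0 < m)%N ->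
  (1 - error (fun S z => read (proj S z)) phi) * ln m%:R <=
  (\sum_S p S * \sum_x a x * \sum_z w x z * ln (L S x z)) + (m%:R - 1) / m%:R.
Proof.
move=> m0; have m0R : (0 : R) < m%:R by rewrite ltr0n.
set I1 := \sum_S _.
have Lpos o i : 0 < prob o ->
    0 < L (patt o) (rows o ((relab o)^-1%g i)) (noises o i).
  move=> po; have nz : prob o != 0 by rewrite gt_eqF.
  move: nz; rewrite /prob !mulf_eq0 !negb_or -!andbA => /and5P[h1 _ _ h2 _].
  apply: L_gt0.
    apply: (@prodr_gt0_factor _ _ (fun i => a (rows o i))) => //.
    by rewrite lt_neqAle eq_sym h1 prodr_ge0.
  apply: (@prodr_gt0_factor _ _ (fun i => w (rows o ((relab o)^-1%g i)) (noises o i))) => //.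
  by rewrite lt_neqAle eq_sym h2 prodr_ge0.
(* The weight [ln m] makes the exponential of the test function equal to [m ^ agreement]. *)
have step : mean (fun o => ln m%:R * (agreement phi o)%:R - ln (joint_ratio o)) <= m%:R - 1.
  apply: gibbs_variational => [||o po|].
  - exact: prob_ge0.
  - exact: prob_sum1.
  - by apply: prodr_gt0 => i _; apply: Lpos.
  apply: le_trans (mean_agreement_ratio phi m0).
  apply: mean_le => o _; rewrite le_eqVlt; apply/orP; left; apply/eqP.
  by rewrite expRM_natr lnK.
have agr : mean (fun o => (agreement phi o)%:R) =
    m%:R * (1 - error (fun S z => read (proj S z)) phi).
  rewrite /error -[X in X - _](mean_cst 1) -[- mean _]mulN1r -meanZ -meanD -meanZ.
  apply: eq_bigr => o _; congr (_ * _).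
  rewrite mulN1r mulrBr mulr1 mulrCA mulfV ?mulr1 ?gt_eqF //.
  apply/eqP; rewrite eq_sym subr_eq -natrD; apply/eqP; congr (_%:R).
  rewrite /agreement /wrong -[LHS]card_ord -cardsT.
  rewrite -[LHS](cardsID [set i | relab o i == decode (fun S z => read (proj S z)) phi o i]).
  by congr (_ + _)%N; apply: eq_card => i; rewrite !inE ?andbT.
have info : mean (fun o => ln (joint_ratio o)) = m%:R * I1.
  transitivity (mean (fun o => \sum_i ln (L (patt o) (rows o i) (noises o (relab o i))))).
    apply: eq_bigr => o _.
    have [->|po] := eqVneq (prob o) 0; first by rewrite !mul0r.
    have po0 : 0 < prob o by rewrite lt_neqAle eq_sym po prob_ge0.
    congr (_ * _); rewrite /joint_ratio (reindex_inj (@perm_inj _ (relab o))) /=.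
    under eq_bigr do rewrite permK.
    apply/esym/ln_prodr => i.
    by have := Lpos _ (relab o i) po0; rewrite permK.
  rewrite mean_sum; under eq_bigr do rewrite (mean_matched _ (fun S x z => ln (L S x z))).
  by rewrite sumr_const card_ord mulr_natl.
have -> : (1 - error (fun S z => read (proj S z)) phi) =
    m%:R^-1 * mean (fun o => (agreement phi o)%:R).
  by rewrite agr mulKf // gt_eqF.
have -> : I1 = m%:R^-1 * mean (fun o => ln (joint_ratio o)).
  by rewrite info mulKf // gt_eqF.
rewrite [leRHS]addrC -lerBlDr -mulrA -mulrBr [leRHS]mulrC ler_pM2l ?invr_gt0 //.
apply: le_trans step; rewrite le_eqVlt; apply/orP; left; apply/eqP.
rewrite mulrC -meanZ -[- mean _]mulN1r -meanZ -meanD.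
by apply: eq_bigr => o _; rewrite mulN1r.
Qed.

End Converse.
End OneShot.

(** * Likelihood ratios of letters and rows *)

Section Letters.
Variable R : realType.
Variables (X : finType) (smax : nat).
Variables (pX : X -> R) (pS : 'I_smax.+1 -> R) (pYX : X -> X -> R).
Hypotheses (hX : is_pmf pX) (hS : is_pmf pS) (hY : forall x, is_pmf (pYX x)).

Definition chan x (y : seq X) : R := \prod_(c <- y) pYX x c.
Definition outp (y : seq X) : R := \sum_x pX x * chan x y.
Definition ratio x y : R := chan x y / outp y.

(* In nats; [take s z] has the law of the output block given [S = s]. *)
Definition info : R := \sum_s pS s * \sum_x pX x *
  \sum_(z : smax.-tuple X) chan x z * ln (ratio x (take s z)).

Lemma chan_ge0 x y : 0 <= chan x y.
Proof. by apply: prodr_ge0 => c _; apply: (hY x).1. Qed.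

Lemma outp_ge0 y : 0 <= outp y.
Proof. by apply: sumr_ge0 => x _; rewrite mulr_ge0 ?chan_ge0 // hX.1. Qed.

Lemma ratio_ge0 x y : 0 <= ratio x y.
Proof. by rewrite divr_ge0 ?chan_ge0 ?outp_ge0. Qed.

Lemma outp_gt0 x y : 0 < pX x -> 0 < chan x y -> 0 < outp y.
Proof.
move=> px cx; rewrite /outp (bigD1 x) //= ltr_pwDl ?mulr_gt0 //.
by apply: sumr_ge0 => x' _; rewrite mulr_ge0 ?chan_ge0 // hX.1.
Qed.

Lemma ratio_gt0 x y : 0 < pX x -> 0 < chan x y -> 0 < ratio x y.
Proof. by move=> px cx; rewrite divr_gt0 // (outp_gt0 px cx). Qed.

Lemma chan_take_gt0 x s y : 0 < chan x y -> 0 < chan x (take s y).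
Proof.
rewrite -{1}(cat_take_drop s y) /chan big_cat /= => H.
rewrite lt_neqAle chan_ge0 andbT eq_sym; apply: contraTneq H => ->.
by rewrite mul0r ltxx.
Qed.

(** The mean is 1 unless [outp y] vanishes, in which case division by zero makes it 0. *)
Lemma ratio_mean y : \sum_x pX x * ratio x y <= 1.
Proof.
under eq_bigr do rewrite mulrA; rewrite -mulr_suml -/(outp y).
by have [->|o0] := eqVneq (outp y) 0; rewrite ?mul0r // mulfV.
Qed.

Lemma sum_chan x n : \sum_(z : n.-tuple X) chan x z = 1.
Proof. exact: sum_tuple_prod1 (hY x).2. Qed.

(** The marginals of the joint law are [pX] and [pS * outp], so [pS] cancels in the density and
    [ratio] remains. Sums over [s]-tuples become sums over prefixes, and [ln 2] converts nats to
    bits. *)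
Lemma capacity_formulaE : capacity_formula pX pS pYX = info / ln 2.
Proof.
have chanE s x (y : s.-tuple X) : chan_prob pYX x y = chan x y.
  by rewrite /chan big_tuple.
have m1 x : \sum_ys joint_XYS pX pS pYX x ys = pX x.
  rewrite /joint_XYS; under eq_bigr do rewrite chanE.
  transitivity (\sum_(s < smax.+1) \sum_(y : s.-tuple X) pX x * pS s * chan x y).
    by rewrite (@sig_big_dep _ _ _ 'I_smax.+1 (fun s => s.-tuple X : finType) xpredT
      (fun _ => xpredT) (fun s y => pX x * pS s * chan x y)).
  under eq_bigr do rewrite -mulr_sumr sum_chan mulr1.
  by rewrite -mulr_sumr hS.2 mulr1.
have m2 ys : \sum_x joint_XYS pX pS pYX x ys = pS (tag ys) * outp (tagged ys).
  rewrite /joint_XYS /outp mulr_sumr; apply: eq_bigr => x _; rewrite chanE; ring.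
rewrite /capacity_formula /mutual_info /info.
under [in RHS]eq_bigr do rewrite mulr_sumr.
rewrite [in RHS]exchange_big mulr_suml; apply: eq_bigr => x _ /=.
transitivity (\sum_(s < smax.+1) \sum_(y : s.-tuple X)
    pX x * pS s * chan x y * ln (ratio x y) / ln 2).
  rewrite (@sig_big_dep _ _ _ 'I_smax.+1 (fun s => s.-tuple X : finType) xpredT
    (fun _ => xpredT) (fun s y => pX x * pS s * chan x y * ln (ratio x y) / ln 2)) /=.
  apply: eq_bigr => ys _; rewrite m1 m2 /joint_XYS chanE.
  case: eqP => [->|/eqP nz]; first by rewrite !mul0r.
  move: (nz); rewrite !mulf_eq0 !negb_or => /andP[/andP[x0 s0] c0].
  rewrite /log2 -[RHS]mulrA; congr (_ * (ln _ / _)); rewrite /ratio.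
  have x0' : 0 < pX x by rewrite lt_neqAle eq_sym x0 hX.1.
  have c0' : 0 < chan x (tagged ys) by rewrite lt_neqAle eq_sym c0 chan_ge0.
  have o0 : outp (tagged ys) != 0 by rewrite gt_eqF // (outp_gt0 x0' c0').
  by field; rewrite x0 s0 o0.
rewrite mulr_suml; apply: eq_bigr => s _.
rewrite (sum_tuple_take_le (q := pYX x) (fun y => ln (ratio x y))); last exact: (hY x).2.
  rewrite !mulr_sumr mulr_suml; apply: eq_bigr => y _; rewrite -/(chan x y); ring.
by rewrite -ltnS.
Qed.

Lemma letters_sum1 : \sum_s \sum_x \sum_(z : smax.-tuple X) pS s * pX x * chan x z = 1.
Proof.
under eq_bigr => s _.
  under eq_bigr => x _ do rewrite -mulr_sumr sum_chan mulr1.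
  rewrite -mulr_sumr hX.2 mulr1; over.
exact: hS.2.
Qed.

Lemma fiber_chan x (s : 'I_smax.+1) (y : seq X) :
  \sum_(z : smax.-tuple X | take s z == y) chan x z = (size y == s)%:R * chan x y.
Proof.
have sn : (s <= smax)%N by rewrite -ltnS.
have := sum_tuple_take_le (fun y' => (y' == y)%:R) sn (hY x).2.
transitivity (\sum_(z : smax.-tuple X) chan x z * (take s z == y)%:R).
  by rewrite big_mkcond; apply: eq_bigr => z _; case: ifP; rewrite ?mulr1 ?mulr0.
rewrite H; case: eqP => sy; last first.
  rewrite mul0r big1 // => t _; case: eqP => [ty|]; last by rewrite mulr0.
  by case: sy; rewrite -ty size_tuple.
pose t := Tuple (introT eqP sy).
rewrite (bigD1 t) //= eqxx mulr1 mul1r [X in _ + X]big1 ?addr0 // => t' tt'.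
case: eqP => [ty|]; last by rewrite mulr0.
by case/eqP: tt'; apply: val_inj.
Qed.

(** * Rows as products of letters *)

Section Rows.
Variable n : nat.

Definition row_prob (g : {ffun 'I_n -> X}) : R := \prod_j pX (g j).
Definition pattern_prob (S : pattern smax n) : R := \prod_j pS (S j).
Definition noise_prob (g : {ffun 'I_n -> X}) (z : {ffun 'I_n -> smax.-tuple X}) : R :=
  \prod_j \prod_(k < smax) pYX (g j) (tnth (z j) k).

Lemma noise_probE g z : noise_prob g z = \prod_j chan (g j) (z j).
Proof. by apply: eq_bigr => j _; rewrite /chan big_tuple. Qed.

Lemma row_prob_ge0 g : 0 <= row_prob g.
Proof. by apply: prodr_ge0 => j _; apply: hX.1. Qed.

Lemma row_prob_sum1 : \sum_g row_prob g = 1.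
Proof. exact: (sum_ffun_prod_pmf (q := fun=> pX) (fun=> hX.2)). Qed.

Lemma pattern_prob_ge0 S : 0 <= pattern_prob S.
Proof. by apply: prodr_ge0 => j _; apply: hS.1. Qed.

Lemma pattern_prob_sum1 : \sum_S pattern_prob S = 1.
Proof. exact: (sum_ffun_prod_pmf (q := fun=> pS) (fun=> hS.2)). Qed.

Lemma noise_prob_ge0 g z : 0 <= noise_prob g z.
Proof. by rewrite noise_probE prodr_ge0 // => j _; apply: chan_ge0. Qed.

Lemma noise_prob_sum1 g : \sum_z noise_prob g z = 1.
Proof.
under eq_bigr do rewrite noise_probE.
exact: (sum_ffun_prod_pmf (q := fun j (z : smax.-tuple X) => chan (g j) z)
  (fun j => sum_chan (g j) smax)).
Qed.

Lemma row_letter_gt0 g z j : 0 < row_prob g -> 0 < noise_prob g z ->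
  0 < pX (g j) /\ 0 < chan (g j) (z j).
Proof.
move=> g0; rewrite noise_probE => z0; split.
  by apply: (prodr_gt0_factor (F := fun j => pX (g j))) g0 => i; apply: hX.1.
by apply: (prodr_gt0_factor (F := fun j => chan (g j) (z j))) z0 => i; apply: chan_ge0.
Qed.

Definition row_ratio (S : pattern smax n) (g : {ffun 'I_n -> X})
    (z : {ffun 'I_n -> smax.-tuple X}) : R :=
  \prod_j ratio (g j) (take (S j) (z j)).

Lemma row_ratio_ge0 S g z : 0 <= row_ratio S g z.
Proof. by apply: prodr_ge0 => j _; apply: ratio_ge0. Qed.

Lemma row_ratio_gt0 (S : pattern smax n) g z j : 0 < row_prob g -> 0 < noise_prob g z ->
  0 < ratio (g j) (take (S j) (z j)).
Proof.
move=> g0 z0; have [x0 c0] := row_letter_gt0 j g0 z0.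
by rewrite ratio_gt0 // chan_take_gt0.
Qed.

Lemma pull_letters (F : pattern smax n -> _ -> _ -> R) :
  \sum_(S : pattern smax n) pattern_prob S * \sum_g row_prob g * \sum_z noise_prob g z * F S g z =
  \sum_(S : pattern smax n) \sum_(g : {ffun 'I_n -> X})
    \sum_(z : {ffun 'I_n -> smax.-tuple X})
      (\prod_j (pS (S j) * pX (g j) * chan (g j) (z j))) * F S g z.
Proof.
apply: eq_bigr => S _; rewrite mulr_sumr; apply: eq_bigr => g _.
rewrite !mulr_sumr; apply: eq_bigr => z _.
by rewrite noise_probE !big_split /= !mulrA.
Qed.

Lemma row_info : \sum_(S : pattern smax n) pattern_prob S * \sum_g row_prob g *
  \sum_z noise_prob g z * ln (row_ratio S g z) = n%:R * info.
Proof.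
transitivity (\sum_(S : pattern smax n) pattern_prob S * \sum_g row_prob g *
  \sum_z noise_prob g z * \sum_j ln (ratio (g j) (take (S j) (z j)))).
  apply: eq_bigr => S _; congr (_ * _); apply: eq_bigr => g _.
  (* The logarithm splits over the columns only when all ratios are positive, which holds off the
     null outcomes. *)
  have [->|g0] := eqVneq (row_prob g) 0; first by rewrite !mul0r.
  congr (_ * _); apply: eq_bigr => z _.
  have [->|z0] := eqVneq (noise_prob g z) 0; first by rewrite !mul0r.
  congr (_ * _); rewrite ln_prodr // => j; apply: row_ratio_gt0.
    by rewrite lt_neqAle eq_sym g0 row_prob_ge0.
  by rewrite lt_neqAle eq_sym z0 noise_prob_ge0.
rewrite pull_letters.
under eq_bigr => S _.
  under eq_bigr => g _.
    under eq_bigr => z _ do rewrite mulr_sumr.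
    rewrite exchange_big; over.
  rewrite exchange_big; over.
rewrite exchange_big /=.
transitivity (\sum_(j < n) info); last by rewrite sumr_const card_ord mulr_natl.
apply: eq_bigr => j _.
rewrite (sum_ffun_marginal3 (c := fun s x (z : smax.-tuple X) => pS s * pX x * chan x z)
  (fun s x (z : smax.-tuple X) => ln (ratio x (take s z))) j letters_sum1).
apply: eq_bigr => s _; rewrite mulr_sumr; apply: eq_bigr => x _.
rewrite !mulr_sumr; apply: eq_bigr => z _; ring.
Qed.

(** Sequences of length at most [smax] form a finite type, as the converse demands of its
    intermediate observation. *)
Definition block (s : nat) (z : smax.-tuple X) : smax.-bseq X :=
  take_bseq s z.

Lemma blockE s z : block s z = take s z :> seq X.
Proof. by []. Qed.

Definition blocks (S : pattern smax n) (z : {ffun 'I_n -> smax.-tuple X}) :=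
  [ffun j => block (S j) (z j)].

Definition read_blocks (y : {ffun 'I_n -> smax.-bseq X}) : seq X :=
  flatten [seq (y j : seq X) | j <- enum 'I_n].

Lemma read_blocksE S z : read_blocks (blocks S z) = repeated_row S z.
Proof.
by congr flatten; apply: eq_map => j; rewrite ffunE blockE.
Qed.

Definition block_prob (s : 'I_smax.+1) (y : smax.-bseq X) : R :=
  (size y == s)%:R * outp y.

Lemma block_prob_sum1 s : \sum_y block_prob s y = 1.
Proof.
transitivity (\sum_(y : smax.-bseq X) \sum_x pX x *
    \sum_(z : smax.-tuple X | block s z == y) chan x z).
  apply: eq_bigr => y _; rewrite /block_prob mulr_sumr; apply: eq_bigr => x _.
  rewrite mulrCA -fiber_chan; congr (_ * _); apply: eq_bigl.
rewrite exchange_big /= -[RHS]hX.2; apply: eq_bigr => x _.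
rewrite -mulr_sumr -[RHS]mulr1 -[X in _ = _ * X](sum_chan x smax).
by rewrite [in RHS](partition_big (block s) xpredT).
Qed.

(** Where [chan] is nonzero, dividing it by [ratio] leaves exactly [outp]; where it vanishes the
    left side is zero, hence only an inequality. *)
Lemma row_ratio_fiber S g y :
  \sum_(z | blocks S z == y) noise_prob g z / row_ratio S g z <=
  \prod_j block_prob (S j) (y j).
Proof.
pose v j (z : smax.-tuple X) := chan (g j) z / ratio (g j) (take (S j) z).
rewrite (eq_bigr (fun z : {ffun 'I_n -> smax.-tuple X} => \prod_j v j (z j))); last first.
  by move=> z _; rewrite noise_probE /row_ratio -prodfV -big_split.
rewrite (sum_ffun_fiber v (fun j => block (S j))).
apply: ler_prod => j _; apply/andP; split.
  by apply: sumr_ge0 => z _; rewrite divr_ge0 ?chan_ge0 ?ratio_ge0.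
rewrite (eq_bigr (fun z : smax.-tuple X => chan (g j) z / ratio (g j) (y j))); last first.
  by move=> z /eqP <-; rewrite /v blockE.
rewrite -mulr_suml (eq_bigl (fun z : smax.-tuple X => take (S j) z == y j)); last first.
  by [].
rewrite fiber_chan /block_prob -mulrA ler_wpM2l //.
rewrite /ratio; have [->|c0] := eqVneq (chan (g j) (y j)) 0.
  by rewrite mul0r outp_ge0.
by rewrite invf_div mulrCA mulfV ?mulr1.
Qed.

End Rows.
End Letters.

(** * Recovering the pattern from the seeds *)

Section Slots.
Variables (X : finType) (smax n : nat).
Implicit Types (S : pattern smax n) (z : {ffun 'I_n -> smax.-tuple X}).

(** The origin, as column and copy index, of each letter of the output row in order. *)
Definition slots S : seq ('I_n * nat) :=
  flatten [seq [seq (j, k) | k <- iota 0 (S j)] | j <- enum 'I_n].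

Lemma pattern_le S j : (S j <= smax)%N.
Proof. by rewrite -ltnS. Qed.

Lemma repeated_row_slots (x0 : X) S z :
  repeated_row S z = [seq nth x0 (z q.1) q.2 | q <- slots S].
Proof.
rewrite /repeated_row /slots map_flatten -map_comp; congr flatten.
apply: eq_map => j /=; rewrite -map_comp /=.
by rewrite -(map_nth_iota0 x0) // size_tuple pattern_le.
Qed.

Lemma slots_lt S q : q \in slots S -> (q.2 < smax)%N.
Proof.
case/flattenP => s /mapP[j _ ->] /mapP[k]; rewrite mem_iota /= add0n => kS -> /=.
exact: leq_trans kS (pattern_le S j).
Qed.

Lemma count_slots S j : count (fun q => j == q.1) (slots S) = S j.
Proof.
rewrite count_flatten -map_comp sumnE big_map big_enum /=.
rewrite (bigD1 j) //= count_map (eq_count (a2 := predT)) => [|k /=]; last by rewrite eqxx.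
rewrite count_predT size_iota big1 ?addn0 // => i ij; rewrite count_map.
rewrite (eq_count (a2 := pred0)) ?count_pred0 // => k /=.
by rewrite eq_sym (negPf ij).
Qed.

Lemma nth_reshape_repeated_row S z (j : 'I_n) :
  nth [::] (reshape [seq (S i : nat) | i <- enum 'I_n] (repeated_row S z)) j =
  take (S j) (z j).
Proof.
have -> : [seq (S i : nat) | i <- enum 'I_n] =
    shape [seq take (S i) (z i) | i <- enum 'I_n].
  rewrite /shape -map_comp; apply: eq_map => i /=.
  by rewrite size_takel // size_tuple pattern_le.
rewrite flattenK (nth_map j) ?size_enum_ord //.
by rewrite nth_ord_enum.
Qed.

End Slots.

(** * Chernoff bounds for row scores and seed columns *)

Section Tests.
Variable R : realType.
Variables (X : finType) (smax : nat).
Variables (pX : X -> R) (pS : 'I_smax.+1 -> R) (pYX : X -> X -> R).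
Hypotheses (hX : is_pmf pX) (hS : is_pmf pS) (hY : forall x, is_pmf (pYX x)).

Lemma chernoff_rows (gamma : R) : gamma < info pX pS pYX ->
  exists r : R, [/\ 0 <= r, r < 1 & forall n,
    \sum_(S : pattern smax n) pattern_prob pS S * \sum_g row_prob pX g *
    \sum_z noise_prob pYX g z *
      (row_ratio pX pYX S g z < expR (n%:R * gamma))%R%:R <= r ^+ n].
Proof.
move=> gI.
pose p (t : 'I_smax.+1 * X * smax.-tuple X) := pS t.1.1 * pX t.1.2 * chan pYX t.1.2 t.2.
pose f (t : 'I_smax.+1 * X * smax.-tuple X) := ln (ratio pX pYX t.1.2 (take t.1.1 t.2)).
have p0 t : 0 <= p t by rewrite !mulr_ge0 ?chan_ge0 ?hX.1 ?hS.1.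
have p1 : \sum_t p t = 1.
  by rewrite -[RHS](letters_sum1 hX hS hY) !pair_bigA.
have pf : gamma < \sum_t p t * f t.
  rewrite (lt_le_trans gI) // le_eqVlt; apply/orP; left; apply/eqP; rewrite /info.
  under eq_bigr => s _.
    under eq_bigr do rewrite mulr_sumr.
    rewrite mulr_sumr; over.
  rewrite pair_bigA /=; under eq_bigr => s _ do rewrite mulr_sumr.
  rewrite pair_bigA /=; apply: eq_bigr => t _; rewrite /p /f; ring.
have [r r0 rho1] := chernoff_exponent p0 p1 pf.
exists (\sum_t p t * expR (r * (gamma - f t))); split => //.
  by apply: sumr_ge0 => t _; rewrite mulr_ge0 ?expR_ge0.
move=> n.
pose c s x (z : smax.-tuple X) := pS s * pX x * chan pYX x z *
  expR (r * (gamma - ln (ratio pX pYX x (take s z)))).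
have -> : \sum_t p t * expR (r * (gamma - f t)) = \sum_s \sum_x \sum_z c s x z.
  by rewrite !pair_bigA.
apply: (@le_trans _ _ (\sum_(S : pattern smax n) \sum_(g : {ffun 'I_n -> X})
    \sum_(z : {ffun 'I_n -> smax.-tuple X}) \prod_j c (S j) (g j) (z j))).
  rewrite pull_letters; apply: ler_sum => S _; apply: ler_sum => g _.
  apply: ler_sum => z _; rewrite [leRHS]big_split /=.
  set q := \prod_j (_ * _ * _).
  have q0 j : 0 <= pS (S j) * pX (g j) * chan pYX (g j) (z j).
    by rewrite !mulr_ge0 ?chan_ge0 ?hX.1 ?hS.1.
  (* Off the null outcomes every ratio is positive, so the indicator of a low score is at most the
     exponential of [r * (n * gamma - ln row_ratio)], which factors over the columns. *)
  have [->|qn0] := eqVneq q 0; first by rewrite !mul0r.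
  have qp : 0 < q by rewrite lt_neqAle eq_sym qn0 prodr_ge0.
  rewrite ler_pM2l //; case: ltP => [lt|_]; last first.
    by apply: prodr_ge0 => j _; apply: expR_ge0.
  have rp j : 0 < ratio pX pYX (g j) (take (S j) (z j)).
    have := prodr_gt0_factor j q0 qp.
    rewrite lt_neqAle q0 andbT eq_sym !mulf_eq0 !negb_or => /andP[/andP[_ gj] cj].
    apply: ratio_gt0 => //; first by rewrite lt_neqAle eq_sym gj hX.1.
    by apply: chan_take_gt0 => //; rewrite lt_neqAle eq_sym cj chan_ge0.
  have rr : 0 < row_ratio pX pYX S g z by apply: prodr_gt0.
  rewrite -expR_sum -mulr_sumr sumrB ln_prodr // sumr_const card_ord -[gamma *+ n]mulr_natl.
  rewrite -[leLHS]expR0 ler_expR mulr_ge0 ?(ltW r0) // subr_ge0 ltW //.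
  by rewrite -ltr_expR lnK.
by rewrite (sum_ffun_prod3 (fun (_ : 'I_n) => c)) prodr_const card_ord.
Qed.

(* The joint law minus the product law: the mean of [dep] under the former exceeds
   the one under the latter by [\sum dep ^+ 2]. *)
Definition dep (x y : X) : R := pX x * (pYX x y - \sum_x' pX x' * pYX x' y).

(** If [dep] vanished identically, output letters would be independent of the input, every ratio of
    positive probability would be 1, and [info] would be 0. *)
Lemma dependent_letter : 0 < info pX pS pYX -> exists x y, dep x y != 0.
Proof.
move=> I0; apply: contrapT => nodep.
have indep x y : 0 < pX x -> pYX x y = \sum_x' pX x' * pYX x' y.
  move=> px; apply: contrapT => ne; apply: nodep; exists x, y.
  apply: mulf_neq0; first by rewrite gt_eqF.
  by rewrite subr_eq0; apply/eqP.
suff I1 : info pX pS pYX = 0 by rewrite I1 ltxx in I0.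
rewrite /info big1 // => s _; rewrite big1 ?mulr0 // => x _.
have [->|x0] := eqVneq (pX x) 0; first by rewrite mul0r.
have px : 0 < pX x by rewrite lt_neqAle eq_sym x0 hX.1.
rewrite big1 ?mulr0 // => z _; set y := take s z.
have oy : outp pX pYX y = chan pYX x y.
  rewrite /outp -[RHS]mul1r -[X in _ = X * _]hX.2 mulr_suml; apply: eq_bigr => x' _.
  have [->|x'0] := eqVneq (pX x') 0; first by rewrite !mul0r.
  have px' : 0 < pX x' by rewrite lt_neqAle eq_sym x'0 hX.1.
  by congr (_ * _); apply: eq_bigr => k _; rewrite !indep.
rewrite /ratio oy; have [->|c0] := eqVneq (chan pYX x y) 0.
  by rewrite mul0r ln0 ?mulr0.
by rewrite mulfV // ln1 mulr0.
Qed.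

Section Seeds.
Variables n B : nat.
Variable x0 : X.

Lemma noise_letter g (j : 'I_n) (k : 'I_smax) (h : X -> R) :
  \sum_(z : {ffun 'I_n -> smax.-tuple X}) noise_prob pYX g z * h (nth x0 (z j) k) =
  \sum_y pYX (g j) y * h y.
Proof.
under eq_bigr do rewrite noise_probE.
rewrite (sum_ffun_marginal (q := fun i (z : smax.-tuple X) => chan pYX (g i) z) j
  (fun z : smax.-tuple X => h (nth x0 z k))); last by move=> i; apply: sum_chan.
exact: (sum_tuple_nth h x0 (ltn_ord k) (hY _).2).
Qed.

Lemma seed_letter_same (j : 'I_n) (k : 'I_smax) (h : X -> X -> R) :
  \sum_g \sum_(z : {ffun 'I_n -> smax.-tuple X})
    row_prob pX g * noise_prob pYX g z * h (g j) (nth x0 (z j) k) =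
  \sum_x \sum_y pX x * pYX x y * h x y.
Proof.
transitivity (\sum_g row_prob pX g * \sum_y pYX (g j) y * h (g j) y).
  apply: eq_bigr => g _; rewrite -(noise_letter g j k (h (g j))) mulr_sumr.
  by apply: eq_bigr => z _; rewrite mulrA.
rewrite (sum_ffun_marginal (q := fun=> pX) j (fun x => \sum_y pYX x y * h x y)).
  by apply: eq_bigr => x _; rewrite mulr_sumr; apply: eq_bigr => y _; rewrite mulrA.
by move=> _; apply: hX.2.
Qed.

Lemma seed_letter_other (j j' : 'I_n) (k : 'I_smax) (h : X -> X -> R) : j != j' ->
  \sum_g \sum_(z : {ffun 'I_n -> smax.-tuple X})
    row_prob pX g * noise_prob pYX g z * h (g j) (nth x0 (z j') k) =
  \sum_x \sum_y pX x * (\sum_x' pX x' * pYX x' y) * h x y.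
Proof.
move=> jj'.
transitivity (\sum_g row_prob pX g * \sum_y pYX (g j') y * h (g j) y).
  apply: eq_bigr => g _; rewrite -(noise_letter g j' k (h (g j))) mulr_sumr.
  by apply: eq_bigr => z _; rewrite mulrA.
rewrite (sum_ffun_marginal2 (q := fun=> pX) (fun x x' => \sum_y pYX x' y * h x y) jj').
  apply: eq_bigr => x _; rewrite mulr_sumr.
  under eq_bigr do rewrite mulrA mulr_sumr.
  rewrite exchange_big /=; apply: eq_bigr => y _.
  by rewrite mulr_sumr mulr_suml; apply: eq_bigr => x' _; ring.
by move=> _; apply: hX.2.
Qed.

(** Exponential Markov inequality; independence of the seed rows turns the moment of the sum into a
    [B]-th power. *)
Lemma seed_chernoff (rho r c : R) (f : X -> X -> R) (j j' : 'I_n) (k : 'I_smax) :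
  0 < r ->
  \sum_g \sum_(z : {ffun 'I_n -> smax.-tuple X}) row_prob pX g * noise_prob pYX g z *
    expR (r * (c - f (g j) (nth x0 (z j') k))) <= rho ->
  \sum_(G : {ffun 'I_B -> {ffun 'I_n -> X}}) (\prod_b row_prob pX (G b)) *
  \sum_(W : {ffun 'I_B -> {ffun 'I_n -> smax.-tuple X}}) (\prod_b noise_prob pYX (G b) (W b)) *
     (\sum_b f (G b j) (nth x0 (W b j') k) <= c *+ B)%R%:R <= rho ^+ B.
Proof.
move=> r0 H.
pose e g (z : {ffun 'I_n -> smax.-tuple X}) :=
  row_prob pX g * noise_prob pYX g z * expR (r * (c - f (g j) (nth x0 (z j') k))).
have e0 g z : 0 <= e g z.
  by rewrite !mulr_ge0 ?row_prob_ge0 ?noise_prob_ge0 ?expR_ge0.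
apply: (@le_trans _ _ (\sum_(G : {ffun 'I_B -> {ffun 'I_n -> X}})
    \sum_(W : {ffun 'I_B -> {ffun 'I_n -> smax.-tuple X}}) \prod_b e (G b) (W b))).
  apply: ler_sum => G _; rewrite mulr_sumr; apply: ler_sum => W _.
  rewrite !big_split /= mulrA ler_wpM2l //.
    by rewrite mulr_ge0 ?prodr_ge0 // => b _; rewrite ?row_prob_ge0 ?noise_prob_ge0.
  case: (leP (\sum_b f _ _)) => [le|_]; last by apply: prodr_ge0 => b _; apply: expR_ge0.
  rewrite -expR_sum -mulr_sumr sumrB sumr_const card_ord.
  by rewrite -[leLHS]expR0 ler_expR mulr_ge0 ?(ltW r0) // subr_ge0.
rewrite (sum_ffun_prod2 (fun=> e)) prodr_const card_ord.
have sum0 : 0 <= \sum_g \sum_z e g z by do 2 (apply: sumr_ge0 => ? _); apply: e0.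
by apply: lerXn2r; rewrite ?nnegrE // (le_trans sum0 H).
Qed.

Variable c : R.

Definition linked (j : 'I_n) (G : {ffun 'I_B -> {ffun 'I_n -> X}}) (col : 'I_B -> X) : bool :=
  c *+ B < \sum_b dep (G b j) (col b).

(** Seed outputs share one length, so the first is consulted; without seeds the value is 0. *)
Definition seed_length (V : 'I_B -> seq X) : nat :=
  oapp (fun b => size (V b)) 0 (insub 0).

Definition pattern_estimate (G : {ffun 'I_B -> {ffun 'I_n -> X}}) (V : 'I_B -> seq X) :
    pattern smax n :=
  [ffun j => inord (count (fun k => linked j G (fun b => nth x0 (V b) k))
                          (iota 0 (seed_length V)))].

(** The tests assumed correct range over all [smax] potential copies of each column, so the
    condition does not mention [S]. Every visible letter is such a copy, and the positions linked to
    [j] are then the [S j] slots of column [j]. *)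
Lemma pattern_estimate_correct (G : {ffun 'I_B -> {ffun 'I_n -> X}})
    (W : {ffun 'I_B -> {ffun 'I_n -> smax.-tuple X}}) (S : pattern smax n) :
  (0 < B)%N ->
  (forall j j' (k : 'I_smax), linked j G (fun b => nth x0 (W b j') k) = (j == j')) ->
  pattern_estimate G (fun b => repeated_row S (W b)) = S.
Proof.
move=> B0 H; apply/ffunP => j; rewrite ffunE -[RHS]inord_val; congr inord.
have -> : seed_length (fun b => repeated_row S (W b)) = size (slots S).
  by rewrite /seed_length insubT /= (repeated_row_slots x0) size_map.
rewrite -[RHS]count_slots -[in RHS](mkseq_nth (j, 0%N) (slots S)) /mkseq count_map.
apply: eq_in_count => k; rewrite mem_iota add0n => /= kS.
have qlt := slots_lt (mem_nth (j, 0%N) kS).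
rewrite -(H j _ (Ordinal qlt)) /=; congr linked; apply: funext => b.
by rewrite (repeated_row_slots x0) (nth_map (j, 0%N)).
Qed.

End Seeds.
End Tests.

(** * Error bounds at a fixed number of columns *)

Section Blocklength.
Variable R : realType.
Variables (X : finType) (smax : nat).
Variables (pX : X -> R) (pS : 'I_smax.+1 -> R) (pYX : X -> X -> R).
Hypotheses (hX : is_pmf pX) (hS : is_pmf pS) (hY : forall x, is_pmf (pYX x)).

Lemma seed_error : 0 < info pX pS pYX ->
  exists c rho : R, [/\ 0 <= rho, rho < 1 & forall n B (x0 : X), (0 < B)%N ->
    \sum_(S : pattern smax n) pattern_prob pS S *
    \sum_(G : {ffun 'I_B -> {ffun 'I_n -> X}}) (\prod_b row_prob pX (G b)) *
    \sum_(W : {ffun 'I_B -> {ffun 'I_n -> smax.-tuple X}})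
      (\prod_b noise_prob pYX (G b) (W b)) *
      (pattern_estimate smax pX pYX x0 c G (fun b => repeated_row S (W b)) != S)%:R
    <= (n * n * smax)%:R * rho ^+ B].
Proof.
move=> /(dependent_letter hX)[x [y dxy]].
pose q y := \sum_x' pX x' * pYX x' y.
pose p1 (t : X * X) := pX t.1 * pYX t.1 t.2.
pose p2 (t : X * X) := pX t.1 * q t.2.
pose f (t : X * X) := dep pX pYX t.1 t.2.
have q0 y' : 0 <= q y' by apply: sumr_ge0 => x' _; rewrite mulr_ge0 ?hX.1 ?(hY _).1.
have q1 : \sum_y' q y' = 1.
  rewrite exchange_big /= -[RHS]hX.2; apply: eq_bigr => x' _.
  by rewrite -mulr_sumr (hY _).2 mulr1.
have p10 t : 0 <= p1 t by rewrite mulr_ge0 ?hX.1 ?(hY _).1.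
have p20 t : 0 <= p2 t by rewrite mulr_ge0 ?hX.1.
have p11 : \sum_t p1 t = 1.
  rewrite -(pair_bigA _ (fun x y => pX x * pYX x y)) /= -[RHS]hX.2.
  by apply: eq_bigr => x' _; rewrite -mulr_sumr (hY _).2 mulr1.
have p21 : \sum_t p2 t = 1.
  rewrite -(pair_bigA _ (fun x y => pX x * q y)) /= -[RHS]hX.2.
  by apply: eq_bigr => x' _; rewrite -mulr_sumr q1 mulr1.
have gap : \sum_t p2 t * f t < \sum_t p1 t * f t.
  (* Since [p1 - p2] is [dep] itself, the gap is the sum of the squares of [dep]. *)
  rewrite -subr_gt0 -sumrB (eq_bigr (fun t => f t ^+ 2)); last first.
    by move=> t _; rewrite /p1 /p2 /f /dep -/(q _); ring.
  rewrite (bigD1 (x, y)) //= ltr_pwDl ?sumr_ge0 // => [|t _]; last exact: sqr_ge0.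
  by rewrite exprn_even_gt0.
set e1 := \sum_t p1 t * f t in gap; set e2 := \sum_t p2 t * f t in gap.
(* The threshold lies midway between the mean for the true column and that for any other column. *)
pose c := (e1 + e2) / 2.
have [r1 r10 H1] : exists2 r, 0 < r & \sum_t p1 t * expR (r * (c - f t)) < 1.
  by apply: chernoff_exponent => //; rewrite -/e1 /c; lra.
have [r2 r20 H2] : exists2 r, 0 < r & \sum_t p2 t * expR (r * (- c - - f t)) < 1.
  apply: (@chernoff_exponent _ _ p2 (fun t => - f t)) => //.
  by rewrite (eq_bigr (fun t => - (p2 t * f t))) => [|t _]; rewrite ?sumrN -/e2 /c ?mulrN //; lra.
set s1 := \sum_t _ in H1; set s2 := \sum_t _ in H2.
exists c, (Num.max s1 s2); split.
- rewrite le_max; apply/orP; left; apply: sumr_ge0 => t _.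
  by rewrite mulr_ge0 ?expR_ge0.
- by rewrite gt_max H1 H2.
move=> n B x0 B0; set rho := Num.max s1 s2.
(* Missed and false links; the sign change in the second case makes both lower deviations, as
   [seed_chernoff] expects. *)
pose bad (G : {ffun 'I_B -> {ffun 'I_n -> X}})
    (W : {ffun 'I_B -> {ffun 'I_n -> smax.-tuple X}}) (u : 'I_n * 'I_n * 'I_smax) :=
  if u.1.1 == u.1.2
  then \sum_b dep pX pYX (G b u.1.1) (nth x0 (W b u.1.2) u.2) <= c *+ B
  else \sum_b - dep pX pYX (G b u.1.1) (nth x0 (W b u.1.2) u.2) <= (- c) *+ B.
apply: (@le_trans _ _ (\sum_(S : pattern smax n) pattern_prob pS S *
    ((n * n * smax)%:R * rho ^+ B))); last first.
  by rewrite -mulr_suml pattern_prob_sum1 // mul1r.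
apply: ler_sum => S _; rewrite ler_wpM2l ?pattern_prob_ge0 //.
pose union : R := \sum_(G : {ffun 'I_B -> {ffun 'I_n -> X}})
    (\prod_b row_prob pX (G b)) *
    \sum_(W : {ffun 'I_B -> {ffun 'I_n -> smax.-tuple X}})
      (\prod_b noise_prob pYX (G b) (W b)) * \sum_u (bad G W u)%:R.
apply: (@le_trans _ _ union); rewrite /union.
  apply: ler_sum => G _; rewrite ler_wpM2l ?prodr_ge0 // => [b _|].
    exact: row_prob_ge0.
  apply: ler_sum => W _; rewrite ler_wpM2l ?prodr_ge0 // => [b _|].
    exact: noise_prob_ge0.
  have [/existsP[u bu]|nobad] := boolP [exists u, bad G W u].
    rewrite (bigD1 u) //= bu; apply: (@le_trans _ _ 1); last by rewrite lerDl sumr_ge0.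
    by case: (_ != _); rewrite ?lexx ?ler01.
  rewrite pattern_estimate_correct ?eqxx ?sumr_ge0 // => j j' k.
  move: nobad; rewrite negb_exists => /forallP/(_ (j, j', k)).
  rewrite /bad /linked /=; case: eqP => jj'; rewrite -ltNge //.
  by rewrite sumrN mulNrn ltrN2 => lt; apply/negbTE; rewrite -leNgt ltW.
under eq_bigr => G _.
  under [X in _ * X]eq_bigr => W _ do rewrite mulr_sumr.
  rewrite [X in _ * X]exchange_big mulr_sumr; over.
rewrite exchange_big /=.
apply: (@le_trans _ _ (\sum_(u : 'I_n * 'I_n * 'I_smax) rho ^+ B)); last first.
  by rewrite sumr_const !card_prod !card_ord mulr_natl.
apply: ler_sum => -[[j j'] k] _; rewrite /bad /=; case: eqP => jj'.
  apply: (@seed_chernoff R X smax pX pYX hX hY n B x0 rho r1 c (dep pX pYX) j j' k r10).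
  rewrite -jj' (seed_letter_same hX hY x0 j k (fun x y => expR (r1 * (c - dep pX pYX x y)))).
  rewrite /rho le_max; apply/orP; left.
  by rewrite (pair_bigA _ (fun x y => pX x * pYX x y * expR (r1 * (c - dep pX pYX x y)))).
apply: (@seed_chernoff R X smax pX pYX hX hY n B x0 rho r2 (- c)
  (fun x y => - dep pX pYX x y) j j' k r20).
move/eqP: jj' => jj'.
rewrite (seed_letter_other hX hY x0 k (fun x y => expR (r2 * (- c - - dep pX pYX x y))) jj').
rewrite /rho le_max; apply/orP; right.
by rewrite (pair_bigA _ (fun x y => pX x * q y * expR (r2 * (- c - - dep pX pYX x y)))).
Qed.

(* The error set in [match_error] is a classical set, the one in [wrong] a
   [{set 'I_m}]. *)
Lemma match_errorE m n B (phi : scheme_map X m n B) :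
  match_error pX pS pYX phi =
  error (row_prob pX (n := n)) (noise_prob pYX (n := n)) (pattern_prob pS (n := n))
    (@repeated_row X smax n) phi.
Proof.
rewrite /error mean_sums /match_error; do 6 (apply: eq_bigr => ? _).
congr (_ * (_%:R / _)); apply: eq_card => i; rewrite [RHS]inE.
by apply/idP/idP; rewrite in_setE.
Qed.

Lemma match_error_ge0 m n B (phi : scheme_map X m n B) :
  0 <= match_error pX pS pYX phi.
Proof.
rewrite match_errorE; apply: mean_ge0.
- exact: row_prob_ge0.
- exact: noise_prob_ge0.
- exact: pattern_prob_ge0.
by move=> o; rewrite divr_ge0.
Qed.

Lemma achievability_bound (gamma : R) : 0 < info pX pS pYX -> gamma < info pX pS pYX ->
  exists r rho : R, [/\ 0 <= r < 1, 0 <= rho < 1 &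
    forall m n B, (0 < m)%N -> (0 < B)%N -> exists phi : scheme_map X m n B,
      match_error pX pS pYX phi <= r ^+ n + 2 * m%:R / expR (n%:R * gamma) +
         (n * n * smax)%:R * rho ^+ B].
Proof.
move=> I0 gI; have [r [r0 r1 H1]] := chernoff_rows hX hS hY gI.
have [c [rho [rho0 rho1 H2]]] := seed_error I0.
exists r, rho; split; rewrite ?r0 ?rho0 // => m n B m0 B0.
(* A default letter for [nth]; it exists because [pX] sums to 1. *)
have [x0] : inhabited X.
  apply: contrapT => noX; have := hX.2; rewrite big1 => [/esym/eqP|x _].
    by rewrite oner_eq0.
  by case: noX.
(* The row is cut by an arbitrary pattern, not only the true one, because the mean bound on the
   score is required for every pattern and every sequence. *)
pose blk (S : pattern smax n) (y : seq X) (j : 'I_n) :=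
  nth [::] (reshape [seq (S i : nat) | i <- enum 'I_n] y) j.
pose score (S : pattern smax n) (g : {ffun 'I_n -> X}) (y : seq X) : R :=
  \prod_j ratio pX pYX (g j) (blk S y j).
have scoreE S g z : score S g (repeated_row S z) = row_ratio pX pYX S g z.
  by apply: eq_bigr => j _; rewrite /blk nth_reshape_repeated_row.
have score0 S g y : 0 <= score S g y.
  by apply: prodr_ge0 => j _; apply: ratio_ge0.
have scoreM S y : \sum_g row_prob pX g * score S g y <= 1.
  under eq_bigr do rewrite -big_split /=.
  rewrite (sum_ffun_prod (fun j x => pX x * ratio pX pYX x (blk S y j))).
  apply: prodr_ile1 => j _; rewrite ratio_mean andbT.
  by apply: sumr_ge0 => x _; rewrite mulr_ge0 ?hX.1 ?ratio_ge0.
have [phi Hphi] := direct_bound (row_prob_ge0 hX (n := n)) (row_prob_sum1 hX n)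
  (noise_prob_ge0 hY (n := n) (smax := smax)) (noise_prob_sum1 smax hY (n := n))
  (pattern_prob_ge0 hS (n := n)) (pattern_prob_sum1 hS n) (@repeated_row X smax n) score0 scoreM
  (pattern_estimate smax pX pYX x0 c (n := n) (B := B)) (expR_gt0 (n%:R * gamma)) m0.
exists phi; rewrite match_errorE (le_trans Hphi) //.
rewrite !lerD //; last exact: H2.
apply: le_trans (H1 n); rewrite le_eqVlt; apply/orP; left; apply/eqP.
do 3 (apply: eq_bigr => ? _; congr (_ * _)); by rewrite scoreE.
Qed.

Lemma converse_letters m n B (phi : scheme_map X m n B) : (0 < m)%N ->
  (1 - match_error pX pS pYX phi) * ln m%:R <=
  n%:R * info pX pS pYX + (m%:R - 1) / m%:R.
Proof.
move=> m0; rewrite match_errorE -row_info //.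
have -> : @repeated_row X smax n = (fun S z => read_blocks (blocks S z)).
  by apply: funext => S; apply: funext => z; rewrite read_blocksE.
apply: (converse_bound (row_prob_ge0 hX (n := n)) (row_prob_sum1 hX n)
  (noise_prob_ge0 hY (n := n) (smax := smax)) (noise_prob_sum1 smax hY (n := n))
  (pattern_prob_ge0 hS (n := n)) (pattern_prob_sum1 hS n)
  (@read_blocks X smax n) (proj := @blocks X smax n) (L := @row_ratio R X smax pX pYX n)
  (Q := fun S y => \prod_j block_prob pX pYX (S j) (y j))) => //.
- by move=> S g z; apply: row_ratio_ge0.
- by move=> S g z g0 z0; apply: prodr_gt0 => j _; apply: row_ratio_gt0.
- by move=> S g y; apply: row_ratio_fiber.
move=> S; rewrite (sum_ffun_prod (fun j => block_prob pX pYX (S j))).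
by rewrite big1 // => j _; apply: block_prob_sum1.
Qed.

(** The converse for a database with a single row, where [ln 1 = 0] and the correction vanishes. *)
Lemma info_ge0 : 0 <= info pX pS pYX.
Proof.
have := @converse_letters 1 1 0 (fun _ _ _ _ => 1%g) isT.
by rewrite ln1 mulr0 subrr mul0r addr0 mul1r.
Qed.

End Blocklength.

(** * Asymptotics *)

Local Open Scope classical_set_scope.

Section Asymptotics.
Variable R : realType.

Lemma ln2_gt0 : 0 < ln 2 :> R.
Proof. by rewrite ln_gt0 // ltr1n. Qed.

Lemma natr_cvg_infty_inv (a : R) : (fun n : nat => a / n%:R) @ \oo --> (0 : R).
Proof.
rewrite -(mulr0 a); apply: cvgMl_tmp.
rewrite -(cvg_shiftn 1%N) /=; under eq_fun do rewrite addn1.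
exact: cvg_harmonic.
Qed.

(** The exponential is split into three equal factors: each of two absorbs one [n], and the third
    remains as a geometric term. *)
Lemma square_exp_bound (a : R) n : 0 < a ->
  (n * n)%:R * expR (- a * n%:R) <= (3 / a) ^+ 2 * expR (- (a / 3)) ^+ n.
Proof.
move=> a0; set e := expR (- (a / 3)) ^+ n.
have eE : expR (- a * n%:R) = e ^+ 3.
  by rewrite /e -!expRM_natr; congr expR; field.
have e0 : 0 < e by rewrite exprn_gt0 // expR_gt0.
have ne : n%:R * e <= 3 / a.
  have H : a / 3 * n%:R <= expR (a / 3 * n%:R).
    by have := expR_ge1Dx (a / 3 * n%:R); lra.
  have E1 : e = (expR (a / 3 * n%:R))^-1 by rewrite /e -expRM_natr mulNr expRN.
  rewrite E1 ler_pdivrMr ?expR_gt0 //.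
  rewrite -(ler_pM2l (_ : 0 < a / 3)) ?divr_gt0 // mulrA.
  have -> : a / 3 * (3 / a) = 1 by field; rewrite gt_eqF.
  by rewrite mul1r.
rewrite eE natrM exprSr mulrA ler_pM2r //.
rewrite -expr2 -exprMn ler_sqr ?nnegrE ?mulr_ge0 ?(ltW e0) //.
by rewrite invr_ge0 ltW.
Qed.

Lemma geometric_cvg0 (q : R) : 0 <= q < 1 -> (fun n => q ^+ n) @ \oo --> (0 : R).
Proof. by case/andP => q0 q1; apply: cvg_expr; rewrite ger0_norm. Qed.

Variables (X : finType) (smax : nat).
Variables (pX : X -> R) (pS : 'I_smax.+1 -> R) (pYX : X -> X -> R).
Hypotheses (hX : is_pmf pX) (hS : is_pmf pS) (hY : forall x, is_pmf (pYX x)).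

Lemma growth_rate_ge0 mseq (r : R) : has_growth_rate mseq r -> 0 <= r.
Proof.
move=> H; rewrite leNgt; apply/negP => r0.
suff : \forall n \near \oo, False by case=> N _ /(_ N)/(_ (leqnn N)).
near=> n; have : log2 (mseq n)%:R / n%:R < 0 :> R.
  by near: n; apply: (cvgr_lt _ H).
apply/negP; rewrite -leNgt !divr_ge0 ?ler0n //; last exact: ltW ln2_gt0.
have [->|m0] := posnP (mseq n); first by rewrite ln0.
by rewrite ln_ge0 // ler1n.
Unshelve. all: by end_near.
Qed.

Lemma achievable_below (d r : R) : 1 <= d -> r < info pX pS pYX / ln 2 ->
  achievable pX pS pYX d r.
Proof.
move=> d1 rI mseq m0 Hm Bseq [c1 [c2 [c10 [_ HB]]]].
have l2 := ln2_gt0.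
have r0 := growth_rate_ge0 Hm.
have rI' : r * ln 2 < info pX pS pYX by rewrite -ltr_pdivlMr.
have I0 : 0 < info pX pS pYX by apply: le_lt_trans rI'; rewrite mulr_ge0 // ltW.
pose gamma := (r * ln 2 + info pX pS pYX) / 2.
have gI : gamma < info pX pS pYX by rewrite /gamma; lra.
(* Eventually [m <= expR (n * gamma1)], so the false-pass term [m / expR (n * gamma)] decays
   geometrically. *)
pose gamma1 := (r * ln 2 + gamma) / 2.
have g1 : r * ln 2 < gamma1 by rewrite /gamma1 /gamma; lra.
have g1g : gamma1 < gamma by rewrite /gamma1 /gamma; lra.
have [r1 [rho [r1b /andP[rho0 rho1] H]]] := achievability_bound hX hS hY I0 gI.
(* A map must be supplied at every [n], while the seed order guarantees seeds only for large [n];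
   hence the guard. *)
pose good n (phi : scheme_map X (mseq n) n (Bseq n)) := (0 < Bseq n)%N ->
  match_error pX pS pYX phi <= r1 ^+ n + 2 * (mseq n)%:R / expR (n%:R * gamma) +
         (n * n * smax)%:R * rho ^+ Bseq n.
have ex n : exists phi, good n phi.
  have [B0|B0] := posnP (Bseq n).
    by exists (fun _ _ _ _ => 1%g); rewrite /good B0.
  by have [phi Hphi] := H (mseq n) n (Bseq n) (m0 n) B0; exists phi.
exists (fun n => projT1 (cid (ex n))).
(* From [rho <= expR (rho - 1)] and [Bseq n >= c1 * n], the latter due to [d >= 1], the seed term
   decays like [n^2 * expR (- a * n)]. *)
pose a := (1 - rho) * c1.
have a0 : 0 < a by rewrite mulr_gt0 // subr_gt0.
pose bound n := r1 ^+ n + 2 * expR (gamma1 - gamma) ^+ n +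
  smax%:R * ((3 / a) ^+ 2 * expR (- (a / 3)) ^+ n).
rewrite /successful.
apply: (@squeeze_cvgr _ _ _ _ (fun=> 0) bound); last 2 first.
- exact: cvg_cst.
- suff : bound @ \oo --> (0 + 2 * 0 + smax%:R * ((3 / a) ^+ 2 * 0) : R).
    by rewrite !mulr0 !addr0.
  apply: cvgD; first apply: cvgD.
  + exact: geometric_cvg0.
  + apply: cvgMl_tmp; apply: geometric_cvg0.
    by rewrite expR_ge0 -expR0 ltr_expR subr_lt0.
  + apply: cvgMl_tmp; apply: cvgMl_tmp; apply: geometric_cvg0.
    by rewrite expR_ge0 -expR0 ltr_expR oppr_lt0 divr_gt0.
have growth : \forall n \near \oo, log2 (mseq n)%:R / n%:R < gamma1 / ln 2 :> R.
  by apply: (cvgr_lt _ Hm); rewrite ltr_pdivlMr.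
near=> n.
have n1 : (0 < n)%N by near: n; exact: nbhs_infty_gt.
have n1R : (0 : R) < n%:R by rewrite ltr0n.
have m0R : (0 : R) < (mseq n)%:R by rewrite ltr0n.
rewrite match_error_ge0 //=; case: cid => phi /= Hphi.
have [Bl _] : c1 * n%:R `^ d <= (Bseq n)%:R /\ (Bseq n)%:R <= c2 * n%:R `^ d.
  by near: n.
have Bn : c1 * n%:R <= (Bseq n)%:R.
  apply: le_trans Bl; rewrite ler_pM2l // -{1}[n%:R]powRr1 ?ler0n //.
  by apply: ler_powR => //; rewrite ler1n.
have B0 : (0 < Bseq n)%N.
  by rewrite -(ltr_nat R) (lt_le_trans _ Bn) // mulr_gt0.
apply: le_trans (Hphi B0) _; rewrite /bound -!addrA lerD2l lerD //.
  rewrite -mulrA ler_pM2l // -expRM_natr mulrBl expRB [gamma * _]mulrC.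
  rewrite ler_pM2r ?invr_gt0 ?expR_gt0 // -[leLHS]lnK ?posrE // ler_expR.
  have : log2 (mseq n)%:R / n%:R < gamma1 / ln 2 by near: n.
  rewrite /log2 ltr_pdivrMr // mulrAC ltr_pM2r ?invr_gt0 //; exact: ltW.
rewrite mulnC natrM -mulrA ler_wpM2l //.
apply: le_trans (square_exp_bound n a0); rewrite ler_wpM2l //.
have rr : rho <= expR (rho - 1) by have := expR_ge1Dx (rho - 1); lra.
apply: (@le_trans _ _ (expR (rho - 1) ^+ Bseq n)).
  by apply: lerXn2r; rewrite ?nnegrE ?expR_ge0.
rewrite -expRM_natr ler_expR /a.
have : 0 < 1 - rho by rewrite subr_gt0.
by nra.
Unshelve. all: by end_near.
Qed.

(** The converse is applied to one database sequence of rate [r], divided by [n * ln 2], and passed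
    to the limit. *)
Lemma achievable_le (d r : R) : 1 <= d -> achievable pX pS pYX d r ->
  r <= info pX pS pYX / ln 2.
Proof.
move=> d1 ach; have l2 := ln2_gt0.
have Ipos := info_ge0 hX hS hY.
(* Negative rates are vacuously achievable. *)
have [r0|r0] := ltP r 0; first by rewrite (le_trans (ltW r0)) // divr_ge0 // ltW.
(* Rounding up to a positive integer at most doubles the value: this adds at most one bit to
   [log2 (mseq n)] and is covered by the constant 2 in the seed order. *)
pose mseq n := (Num.truncn (2 `^ (n%:R * r) : R)).+1.
pose Bseq n := (Num.truncn (n%:R `^ d : R)).+1.
have ceil (x : R) : 1 <= x -> x <= (Num.truncn x).+1%:R <= 2 * x.
  move=> x1; have x0 : 0 <= x by lra.
  have /andP[h1 h2] := truncn_itv x0.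
  by rewrite (ltW h2) /= -natr1; lra.
have m1 n : 1 <= 2 `^ (n%:R * r) :> R.
  by rewrite -[leLHS](powRr0 2) ler_powR ?mulr_ge0 // ler1n.
have lnpow n : ln (2 `^ (n%:R * r)) = n%:R * r * ln 2 :> R.
  by rewrite ln_powR.
have Hm : has_growth_rate mseq r.
  apply: (@squeeze_cvgr _ _ _ _ (fun=> r) (fun n => r + 1 / n%:R)).
  - near=> n.
    have n1 : (0 : R) < n%:R by rewrite ltr0n; near: n; exact: nbhs_infty_gt.
    have /andP[h1 h2] := ceil _ (m1 n).
    have p0 : 0 < 2 `^ (n%:R * r) :> R by rewrite powR_gt0.
    rewrite ler_pdivlMr // /log2 ler_pdivlMr // ler_pdivrMr // ler_pdivrMr //.
    apply/andP; split.
      by rewrite [r * _]mulrC -lnpow ler_ln // posrE ltr0n.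
    have -> : (r + 1 / n%:R) * n%:R * ln 2 = n%:R * r * ln 2 + ln 2.
      by field; rewrite gt_eqF.
    rewrite -lnpow -lnM ?posrE //.
    by rewrite ler_ln ?posrE ?mulr_gt0 ?ltr0n // mulrC.
  - exact: cvg_cst.
  - suff : (fun n => r + 1 / n%:R) @ \oo --> r + 0 by rewrite addr0.
    by apply: cvgD; [exact: cvg_cst | exact: natr_cvg_infty_inv].
have HB : seed_order Bseq d.
  exists 1, 2; do 2 split => //; near=> n.
  have n1 : (1 : R) <= n%:R by rewrite ler1n; near: n; exact: nbhs_infty_gt.
  have n1d : 1 <= n%:R `^ d :> R.
    by rewrite -[leLHS](powRr0 n%:R) ler_powR // (le_trans _ d1).
  by have /andP[h1 h2] := ceil _ n1d; rewrite mul1r.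
have [phi Hphi] := ach mseq (fun=> isT) Hm Bseq HB.
have lim1 : (fun n => (1 - match_error pX pS pYX (phi n)) *
    (log2 (mseq n)%:R / n%:R)) @ \oo --> (1 - 0) * r.
  by apply: cvgM => //; apply: cvgB => //; exact: cvg_cst.
have lim2 : (fun n : nat => info pX pS pYX / ln 2 + (ln 2)^-1 / n%:R) @ \oo -->
    info pX pS pYX / ln 2 + 0.
  apply: cvgD; first exact: cvg_cst.
  exact: natr_cvg_infty_inv.
rewrite subr0 mul1r in lim1; rewrite addr0 in lim2.
apply: (ler_cvg_to lim1 lim2); near=> n.
have n1 : (0 : R) < n%:R by rewrite ltr0n; near: n; exact: nbhs_infty_gt.
have := converse_letters hX hS hY (phi n) (isT : (0 < mseq n)%N).
set e := _ - _; set l := ln _ => H.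
have H2 : e * l <= n%:R * info pX pS pYX + 1.
  apply: le_trans H _; rewrite lerD2l ler_pdivrMr ?ltr0n // mul1r.
  by rewrite lerBlDr lerDl.
rewrite /log2 -/l.
have -> : e * (l / ln 2 / n%:R) = (e * l) / (ln 2 * n%:R).
  by field; rewrite !gt_eqF.
rewrite ler_pdivrMr ?mulr_gt0 //; apply: le_trans H2 _.
rewrite le_eqVlt; apply/orP; left; apply/eqP; field.
by rewrite !gt_eqF.
Unshelve. all: by end_near.
Qed.

End Asymptotics.

Local Close Scope classical_set_scope.

Theorem theorem1 (R : realType) (X : finType) (smax : nat)
    (pX : X -> R) (pS : 'I_smax.+1 -> R) (pYX : X -> X -> R) :
  is_pmf pX -> is_pmf pS -> (forall x : X, is_pmf (pYX x)) ->
  forall d : R, 1 <= d ->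
  matching_capacity pX pS pYX d = capacity_formula pX pS pYX.
Proof.
move=> hX hS hY d d1; rewrite capacity_formulaE //.
set I := _ / _; rewrite /matching_capacity.
set A := (fun r => _).
have ubA : ubound A I by move=> r; apply: achievable_le.
have below r : r < I -> A r by apply: achievable_below.
apply/eqP; rewrite eq_le; apply/andP; split.
  (* Every rate below [I] is achievable, so [I - 1] shows that the set is nonempty. *)
  by apply: ge_sup => //; exists (I - 1); apply: below; lra.
rewrite leNgt; apply/negP => lt.
have Am : A ((sup A + I) / 2) by apply: below; lra.
have : (sup A + I) / 2 <= sup A.
  by apply: sup_upper_bound => //; split; [exists ((sup A + I) / 2)|exists I].
lra.
Qed.
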